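(* There is a randomized algorithm which, given a formula $\varphi(x_1,\dots,x_k)$ of bounded linear real arithmetic (each free variable $x_i$ ranging over a given bounded interval $D_i=[a_i,b_i]\subseteq\mathbb{R}$, existential quantifiers allowed at the top level) and a rational number $\gamma>0$, runs in time polynomial in $|\varphi|+\gamma^{-1}$, has oracle access to satisfiability of formulas of the combined theory of bounded integer arithmetic and linear real arithmetic (each oracle query counting as one step), and outputs a value $A(\varphi,\gamma)$ such that $$\Pr\Bigl[\,\bigl|A(\varphi,\gamma)-\#\varphi\bigr|\le \gamma\prod_{i=1}^{k}(b_i-a_i)\Bigr]\ge 3/4,$$ where the probability is over the internal coin tosses of the algorithm. That is, the model counting problem for bounded linear real arithmetic can be approximated with an additive error by a polynomial-time randomized algorithm with such an oracle.
   Context: Bounded linear real arithmetic: formulas of linear real arithmetic $\varphi(x_1,\dots,x_k)$ in which each free variable $x_i$ comes with a bounded domain $D_i=[a_i,b_i]\subseteq\mathbb{R}$, and existential (but no universal) quantifiers may occur at the top level. A model of $\varphi$ is a tuple $a\in D_1\times\dots\times D_k$ such that $\varphi(a)$ holds; $\#\varphi$ (the model count) is the Lebesgue measure (volume) of the set of models of $\varphi$; the a priori upper bound on $\#\varphi$ is $\prod_{i=1}^k(b_i-a_i)$. The combined theory allows bounded integer variables (integer arithmetic) together with real variables (linear real arithmetic). An oracle answers a satisfiability query in a single time step. *)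

(* Defs.v *)
From Stdlib Require QArith_base.
From Corelib Require Import BinNums.
From HB Require Import structures.
From mathcomp Require Import all_boot all_order all_algebra.
From mathcomp Require ssrZ.
From mathcomp Require Import all_classical all_reals all_analysis.

Set Implicit Arguments.
Unset Strict Implicit.
Unset Printing Implicit Defensive.

Import Order.TTheory GRing.Theory Num.Theory.
Import numFieldNormedType.Exports.

Local Open Scope ring_scope.
Local Open Scope classical_set_scope.

Notation Q := QArith_base.Q.
Notation int_of_Z := ssrZ.int_of_Z.

(** * Linear arithmetic *)

(* [Q] is used as a type of numerals (numerator and denominator written in
   binary, not necessarily in lowest terms). *)
Definition Qval (F : fieldType) (q : Q) : F :=
  (int_of_Z (QArith_base.Qnum q))%:~R / (int_of_Z (Zpos (QArith_base.Qden q)))%:~R.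

Inductive term :=
| TVar of nat
| TCst of Q
| TAdd of term & term
| TScale of Q & term.

Inductive form :=
| FLe of term & term
| FLt of term & term
| FEq of term & term
| FNot of form
| FAnd of form & form
| FOr of form & form.

Fixpoint teval (R : realType) (v : nat -> R) (t : term) : R :=
  match t with
  | TVar i => v i
  | TCst q => Qval R q
  | TAdd t1 t2 => teval v t1 + teval v t2
  | TScale q t1 => Qval R q * teval v t1
  end.

Fixpoint feval (R : realType) (v : nat -> R) (f : form) : bool :=
  match f with
  | FLe t1 t2 => teval v t1 <= teval v t2
  | FLt t1 t2 => teval v t1 < teval v t2
  | FEq t1 t2 => teval v t1 == teval v t2
  | FNot f1 => ~~ feval v f1
  | FAnd f1 f2 => feval v f1 && feval v f2
  | FOr f1 f2 => feval v f1 || feval v f2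
  end.

Fixpoint term_vars_lt (n : nat) (t : term) : bool :=
  match t with
  | TVar i => (i < n)%N
  | TCst _ => true
  | TAdd t1 t2 => term_vars_lt n t1 && term_vars_lt n t2
  | TScale _ t1 => term_vars_lt n t1
  end.

Fixpoint form_vars_lt (n : nat) (f : form) : bool :=
  match f with
  | FLe t1 t2 | FLt t1 t2 | FEq t1 t2 => term_vars_lt n t1 && term_vars_lt n t2
  | FNot f1 => form_vars_lt n f1
  | FAnd f1 f2 | FOr f1 f2 => form_vars_lt n f1 && form_vars_lt n f2
  end.

(** ** Bounded linear real arithmetic *)

(* The formula [exists y_1 ... y_m, psi(x_1, ..., x_k, y_1, ..., y_m)] with psi
   quantifier-free: [lra_dom] lists the domains [a_i, b_i] of the k free
   variables, which are the variables 0, ..., k - 1 of [lra_matrix], and the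
   m = [lra_nex] quantified ones are the variables k, ..., k + m - 1. *)
Record lra := LRA {
  lra_dom : seq (Q * Q);
  lra_nex : nat;
  lra_matrix : form }.

Definition lra_arity (phi : lra) : nat := size (lra_dom phi).

Definition lra_wf (phi : lra) : bool :=
  all (fun d => Qval rat d.1 <= Qval rat d.2) (lra_dom phi) &&
  form_vars_lt (lra_arity phi + lra_nex phi) (lra_matrix phi).

Definition lra_models (R : realType) (phi : lra) :
    set ((lra_arity phi).-tuple R) :=
  [set x | (forall i : 'I_(lra_arity phi),
              let d := tnth (in_tuple (lra_dom phi)) i in
              Qval R d.1 <= tnth x i <= Qval R d.2) /\
           exists y : (lra_nex phi).-tuple R,
             feval (nth 0 (x ++ y)) (lra_matrix phi)].

(* k-dimensional Lebesgue measure, as the product of k copies of the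
   one-dimensional one (R^k.+1 being identified with R * R^k). *)
Fixpoint lebesgue (R : realType) (k : nat) :
    set (k.-tuple (measurableTypeR R)) -> \bar R :=
  match k with
  | 0 => fun A => \d_[tuple] A
  | k'.+1 => fun A =>
      (lebesgue_measure \x @lebesgue R k')%E
        [set z : measurableTypeR R * k'.-tuple (measurableTypeR R)
               | A [tuple of z.1 :: z.2]]
  end.

(* The set of models is bounded, so [fine] only drops the injection into the
   extended reals. *)
Definition model_count (R : realType) (phi : lra) : R :=
  fine (lebesgue (@lra_models R phi)).

Definition lra_bound (R : realType) (phi : lra) : R :=
  \prod_(d <- lra_dom phi) (Qval R d.2 - Qval R d.1).

(** ** Bounded integer arithmetic combined with linear real arithmetic *)

Inductive vsort :=
| SInt of Z & Z (* integers between two given bounds *)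
| SReal.

(* Atoms may mix variables of both sorts.  No quantifier prefix is needed:
   existentially quantified variables are free as far as satisfiability is
   concerned, and bounds on real variables are expressible as atoms. *)
Record mixed := Mixed {
  mixed_sorts : seq vsort;
  mixed_matrix : form }.

Definition mixed_wf (psi : mixed) : bool :=
  form_vars_lt (size (mixed_sorts psi)) (mixed_matrix psi).

Definition in_sort (R : realType) (s : vsort) (x : R) : Prop :=
  match s with
  | SInt l u => exists2 z : int, int_of_Z l <= z <= int_of_Z u & x = z%:~R
  | SReal => True
  end.

Definition mixed_sat (R : realType) (psi : mixed) : Prop :=
  exists2 x : (size (mixed_sorts psi)).-tuple R,
    (forall i, in_sort (tnth (in_tuple (mixed_sorts psi)) i) (tnth x i)) &
    feval (nth 0 x) (mixed_matrix psi).

(** * Machine model *)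

(* Data are binary trees, as in Lisp or in N. D. Jones' language WHILE. *)
Inductive tree := Leaf | Node of tree & tree.

Fixpoint tsize (t : tree) : nat :=
  if t is Node l r then (tsize l + tsize r).+1 else 1%N.

Definition tree_of_bool (b : bool) : tree := if b then Node Leaf Leaf else Leaf.

(* A program is a finite list of mutually recursive first-order functions of one
   argument, given by their bodies; execution starts with function 0.  Variables
   are de Bruijn indices; [ECase e e0 e1] branches on whether e is a leaf or a
   node and in the latter case binds the left subtree to variable 0 and the right
   one to variable 1 of e1. *)
Inductive expr :=
| EVar of nat
| ELeaf
| ENode of expr & expr
| ECase of expr & expr & expr
| ELet of expr & expr
| ECall of nat & expr
| EFlip
| EQuery of expr.

Definition program := seq expr.

(* [evalsto P O env w e v w' c]: in the environment env and with w the coin tosses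
   still to come, e evaluates to v, leaving the coin tosses w', in time c.  Every
   operation takes one time step (trees are shared pointer structures, so this is
   polynomially equivalent to Turing machines).  An oracle call answers in a
   single step too, but one is also charged for every node of the query, as when
   it is written on an oracle tape: otherwise sharing would make exponentially
   large queries affordable. *)
Inductive evalsto (P : program) (O : tree -> bool) :
  seq tree -> seq bool -> expr -> tree -> seq bool -> nat -> Prop :=
| eval_var env w i :
    evalsto P O env w (EVar i) (nth Leaf env i) w 1
| eval_leaf env w :
    evalsto P O env w ELeaf Leaf w 1
| eval_node env w e1 e2 v1 v2 w1 w2 c1 c2 :
    evalsto P O env w e1 v1 w1 c1 -> evalsto P O env w1 e2 v2 w2 c2 ->
    evalsto P O env w (ENode e1 e2) (Node v1 v2) w2 (c1 + c2).+1
| eval_case_leaf env w e e0 e1 v w1 w2 c1 c2 :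
    evalsto P O env w e Leaf w1 c1 -> evalsto P O env w1 e0 v w2 c2 ->
    evalsto P O env w (ECase e e0 e1) v w2 (c1 + c2).+1
| eval_case_node env w e e0 e1 l r v w1 w2 c1 c2 :
    evalsto P O env w e (Node l r) w1 c1 ->
    evalsto P O [:: l, r & env] w1 e1 v w2 c2 ->
    evalsto P O env w (ECase e e0 e1) v w2 (c1 + c2).+1
| eval_let env w e1 e2 v1 v2 w1 w2 c1 c2 :
    evalsto P O env w e1 v1 w1 c1 -> evalsto P O (v1 :: env) w1 e2 v2 w2 c2 ->
    evalsto P O env w (ELet e1 e2) v2 w2 (c1 + c2).+1
| eval_call env w f e body v1 v2 w1 w2 c1 c2 :
    onth P f = Some body ->
    evalsto P O env w e v1 w1 c1 -> evalsto P O [:: v1] w1 body v2 w2 c2 ->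
    evalsto P O env w (ECall f e) v2 w2 (c1 + c2).+1
| eval_flip env w b :
    evalsto P O env (b :: w) EFlip (tree_of_bool b) w 1
| eval_query env w e v w1 c :
    evalsto P O env w e v w1 c ->
    evalsto P O env w (EQuery e) (tree_of_bool (O v)) w1 (c + tsize v).+1.

(* As for queries, one time step is charged for every node of the output. *)
Definition runs_within (P : program) (O : tree -> bool) (n : nat)
    (input : tree) (w : seq bool) (output : tree) : Prop :=
  exists w' c, evalsto P O [:: input] w (ECall 0 (EVar 0)) output w' c /\
               (c + tsize output <= n)%N.

(* Probability of the event E when n independent fair coins are tossed. *)
Definition coin_prob (R : realType) (n : nat) (E : pred (n.-tuple bool)) : R :=
  #|E|%:R / 2 ^+ n.

(** * Encodings *)

Fixpoint enc_seq (T : Type) (enc : T -> tree) (s : seq T) : tree :=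
  if s is x :: s' then Node (enc x) (enc_seq enc s') else Leaf.

(* Unary.  It is used only for syntactic tags, for the number of quantifiers and
   for variable indices, which a well-formed formula bounds by its number of
   declared variables. *)
Definition enc_nat (n : nat) : tree := iter n (Node Leaf) Leaf.

(* Binary, least significant bit first. *)
Fixpoint enc_pos (p : positive) : tree :=
  match p with
  | xH => Leaf
  | xO p' => Node (tree_of_bool false) (enc_pos p')
  | xI p' => Node (tree_of_bool true) (enc_pos p')
  end.

Definition enc_Z (z : Z) : tree :=
  match z with
  | Z0 => Leaf
  | Zpos p => Node (tree_of_bool false) (enc_pos p)
  | Zneg p => Node (tree_of_bool true) (enc_pos p)
  end.

Definition enc_Q (q : Q) : tree := Node (enc_Z (QArith_base.Qnum q)) (enc_pos (QArith_base.Qden q)).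

Fixpoint enc_term (t : term) : tree :=
  match t with
  | TVar i => Node (enc_nat 0) (enc_nat i)
  | TCst q => Node (enc_nat 1) (enc_Q q)
  | TAdd t1 t2 => Node (enc_nat 2) (Node (enc_term t1) (enc_term t2))
  | TScale q t1 => Node (enc_nat 3) (Node (enc_Q q) (enc_term t1))
  end.

Fixpoint enc_form (f : form) : tree :=
  match f with
  | FLe t1 t2 => Node (enc_nat 0) (Node (enc_term t1) (enc_term t2))
  | FLt t1 t2 => Node (enc_nat 1) (Node (enc_term t1) (enc_term t2))
  | FEq t1 t2 => Node (enc_nat 2) (Node (enc_term t1) (enc_term t2))
  | FNot f1 => Node (enc_nat 3) (enc_form f1)
  | FAnd f1 f2 => Node (enc_nat 4) (Node (enc_form f1) (enc_form f2))
  | FOr f1 f2 => Node (enc_nat 5) (Node (enc_form f1) (enc_form f2))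
  end.

Definition enc_lra (phi : lra) : tree :=
  Node (enc_seq (fun d => Node (enc_Q d.1) (enc_Q d.2)) (lra_dom phi))
       (Node (enc_nat (lra_nex phi)) (enc_form (lra_matrix phi))).

Definition lra_size (phi : lra) : nat := tsize (enc_lra phi).

Definition enc_sort (s : vsort) : tree :=
  if s is SInt l u then Node (enc_Z l) (enc_Z u) else Leaf.

Definition enc_mixed (psi : mixed) : tree :=
  Node (enc_seq enc_sort (mixed_sorts psi)) (enc_form (mixed_matrix psi)).

(* Nothing is assumed about queries that do not encode a well-formed formula. *)
Definition is_sat_oracle (R : realType) (O : tree -> bool) : Prop :=
  forall psi, mixed_wf psi -> (O (enc_mixed psi) <-> mixed_sat R psi).

Fixpoint pos_bits (p : positive) : seq bool :=
  match p with
  | xH => [:: true]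
  | xO p' => rcons (pos_bits p') false
  | xI p' => rcons (pos_bits p') true
  end.

(* The tolerance n/d is written on two aligned binary tracks, most significant
   bits first and padded with leading zeros to a common length.  With this
   layout the order of magnitude of n/d can be read off a prefix of length
   O(log(1 + d/n)), so that a running time polynomial in |phi| + d/n makes sense
   although it does not depend on the lengths of n and d. *)
Definition enc_tolerance (g : Q) : tree :=
  if QArith_base.Qnum g is Zpos n then
    let bn := pos_bits n in
    let bd := pos_bits (QArith_base.Qden g) in
    let m := maxn (size bn) (size bd) in
    let pad s := nseq (m - size s) false ++ s in
    enc_seq (fun b => Node (tree_of_bool b.1) (tree_of_bool b.2))
            (zip (pad bn) (pad bd))
  else Leaf.

Definition enc_input (phi : lra) (g : Q) : tree :=
  Node (enc_lra phi) (enc_tolerance g).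

(* Main.v *)
(** Monte Carlo counting.  A random dyadic point of the box is drawn by tossing
    M coins for each coordinate, and the oracle decides whether the matrix is
    satisfiable at that point.  The mean of 2^(2e+8) such tests, where 2^e is
    about 1/gamma, is accurate by Chebyshev's inequality.  It is multiplied by
    the volume of the box, and rounded to a dyadic number, by a binary search
    whose comparisons are again oracle queries: the volume is described by
    linear equations V_(i+1) = (b_i - a_i) V_i.

    That a grid of exponentially small mesh is fine enough needs no quantifier
    elimination.  Fixing the signs of the L atoms of the matrix cuts out a
    convex set, and so does its projection; hence the set of models is a union
    of 3^L convex sets, and its intersection with a line parallel to an axis is
    a union of 3^L intervals, each of which crosses the boundary of at most two
    cells.  Replacing integrals by grid averages one coordinate at a time gives
    the error k * 2 * 3^L / 2^M relative to the volume of the box. *)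

Require Import Defs.
From Corelib Require Import BinNums PosDef.
From HB Require Import structures.
From mathcomp Require Import all_boot all_order all_algebra.
From mathcomp Require Import all_classical all_reals all_analysis.
From mathcomp Require Import measurable_realfun.
From mathcomp Require Import zify ring lra.
Set Implicit Arguments.
Unset Strict Implicit.
Unset Printing Implicit Defensive.
Import Order.TTheory GRing.Theory Num.Theory.
Local Open Scope ring_scope.
Local Open Scope classical_set_scope.

(** * Averages over coin tosses *)

Section CoinMean.
Variable R : realFieldType.
Implicit Types f g : seq bool -> R.

(** Three features of the setting shape the proof. Programs handle only trees, and beyond appending
    a bit no arithmetic on numerals is programmed: a number is a unary list (which is also the code
    of a power of two), a list of coins, or an unevaluated term, and the rest is left to the oracle.
    [lebesgue] is an iterated integral whose section volumes are not shown to be measurable; the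
    induction on the dimension encloses them between measurable functions and relies on monotonicity
    of the integral, which holds for arbitrary nonnegative functions. The tolerance is gamma times
    the volume V of the box, so a rounding error 2^-M is harmless only if V is bounded below; a flat
    box, V = 0, demands the exact answer 0, which rounding downwards delivers.

    The grid, the sampling and the rounding each take a quarter of the tolerance. As 1/gamma is at
    most 2^(e+1), gamma/4 is at least 2^-(e+3), and the mean of 2^(2e+8) samples of variance at most
    1 deviates by more with probability at most 2^(2e+6)/2^(2e+8) = 1/4. *)

Fixpoint coin_mean (n : nat) (f : seq bool -> R) : R :=
  if n is n'.+1 then
    (coin_mean n' (fun w => f (true :: w)) +
     coin_mean n' (fun w => f (false :: w))) / 2
  else f [::].

Lemma eq_coin_mean n f g : (forall w, size w = n -> f w = g w) ->
  coin_mean n f = coin_mean n g.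
Proof.
elim: n f g => [|n IHn] f g fg /=; first exact: fg.
by congr ((_ + _) / 2); apply: IHn => w sw; apply: fg; rewrite /= sw.
Qed.

Lemma le_coin_mean n f g : (forall w, size w = n -> f w <= g w) ->
  coin_mean n f <= coin_mean n g.
Proof.
elim: n f g => [|n IHn] f g fg /=; first exact: fg.
have := IHn (fun w => f (true :: w)) (fun w => g (true :: w)).
have := IHn (fun w => f (false :: w)) (fun w => g (false :: w)).
move=> H1 H2.
have {}H1 := H1 (fun w sw => fg (false :: w) (congr1 S sw)).
have {}H2 := H2 (fun w sw => fg (true :: w) (congr1 S sw)).
lra.
Qed.

Lemma coin_mean_cst n (c : R) : coin_mean n (fun=> c) = c.
Proof. by elim: n => //= n ->; field. Qed.

Lemma coin_meanD n f g :
  coin_mean n (fun w => f w + g w) = coin_mean n f + coin_mean n g.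
Proof. by elim: n f g => //= n IHn f g; rewrite !IHn; field. Qed.

Lemma coin_meanZ n (c : R) f :
  coin_mean n (fun w => c * f w) = c * coin_mean n f.
Proof. by elim: n f => //= n IHn f; rewrite !IHn; field. Qed.

Lemma coin_meanB n f g :
  coin_mean n (fun w => f w - g w) = coin_mean n f - coin_mean n g.
Proof.
rewrite -[X in _ + X]mulN1r -coin_meanZ -coin_meanD.
by apply: eq_coin_mean => w _; rewrite mulN1r.
Qed.

Lemma coin_mean_ge0 n f : (forall w, size w = n -> 0 <= f w) ->
  0 <= coin_mean n f.
Proof. by move=> f0; rewrite -[leLHS](coin_mean_cst n); exact: le_coin_mean. Qed.

Lemma coin_mean_le_dist n f g (e : R) :
  (forall w, size w = n -> `|f w - g w| <= e) ->
  `|coin_mean n f - coin_mean n g| <= e.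
Proof.
move=> fg; rewrite -coin_meanB ler_norml -(coin_mean_cst n (- e)).
rewrite -[X in _ && (_ <= X)](coin_mean_cst n e).
by apply/andP; split; apply: le_coin_mean => w /fg; rewrite ler_norml => /andP[].
Qed.

(** Independence of disjoint blocks of coins; the recursive form of the average makes it a plain
    induction. *)
Lemma coin_mean_cat m n f : coin_mean (m + n) f =
  coin_mean m (fun u => coin_mean n (fun v => f (u ++ v))).
Proof. by elim: m f => //= m IHm f; rewrite !IHm. Qed.

Lemma coin_mean_exchange m n (f : seq bool -> seq bool -> R) :
  coin_mean m (fun u => coin_mean n (f u)) =
  coin_mean n (fun v => coin_mean m (f^~ v)).
Proof.
elim: m f => //= m IHm f; rewrite !IHm -coin_meanD mulrC -coin_meanZ.
by apply: eq_coin_mean => w _; rewrite mulrC.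
Qed.

(** Ties the recursion to the uniform distribution on [n.-tuple bool], hence to [coin_prob]. *)
Lemma coin_mean_sum n f :
  coin_mean n f = (\sum_(w : n.-tuple bool) f w) / 2 ^+ n.
Proof.
elim: n f => [|n IHn] f /=.
  rewrite expr0 divr1 (big_pred1 [tuple]) // => w.
  by rewrite [w]tuple0; exact/esym/eqxx.
rewrite !IHn -mulrDl exprS invfM mulrA mulrAC; congr (_ * _).
have hb : bijective (fun p : bool * n.-tuple bool => [tuple of p.1 :: p.2]).
  exists (fun w : n.+1.-tuple bool => (thead w, [tuple of behead w])).
    by case=> b w /=; congr (_, _); exact: val_inj.
  by move=> w; rewrite [RHS]tuple_eta.
rewrite (reindex (fun p : bool * n.-tuple bool => [tuple of p.1 :: p.2])) /=;
  last exact: onW_bij.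
rewrite -(pair_big xpredT xpredT (fun b (w : n.-tuple bool) => f (b :: w))) /=.
by rewrite big_bool /= mulrC.
Qed.

Fixpoint nat_of_bits (w : seq bool) : nat :=
  if w is b :: w' then (b + (nat_of_bits w').*2)%N else 0%N.

Lemma sum_double (n : nat) (g : nat -> R) : \sum_(0 <= j < n.*2) g j =
  \sum_(0 <= j < n) (g j.*2.+1 + g j.*2).
Proof.
elim: n => [|n IHn]; first by rewrite !big_nil.
by rewrite doubleS !big_nat_recr //= IHn; ring.
Qed.

(** The first coin is the parity of the number, so the two branches of the recursion are the sums
    over odd and over even indices. *)
Lemma coin_mean_nat n (g : nat -> R) :
  coin_mean n (g \o nat_of_bits) = (\sum_(0 <= j < 2 ^ n) g j) / 2 ^+ n.
Proof.
elim: n g => [|n IHn] g /=; first by rewrite big_nat1 expr0 divr1.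
rewrite (IHn (fun j => g j.*2.+1)) (IHn (fun j => g j.*2)) -mulrDl -big_split /=.
by rewrite exprS invfM expnS mul2n sum_double /= mulrA mulrAC.
Qed.

Lemma nat_of_bits_lt w : (nat_of_bits w < 2 ^ size w)%N.
Proof. by elim: w => //= b w; rewrite expnS; case: b; lia. Qed.

End CoinMean.

(** * Grid sums and Lebesgue measure *)

Section Grid1.
Variables (R : realType) (M : finType).
Implicit Types (I : M -> set R).

Definition crosses (D : set R) (x y : R) : Prop :=
  exists p q : R, [/\ x <= p < y, x <= q < y, D p & ~ D q].

(** Of three crossed cells, the middle one would lie between points of [D] in the outer two, hence
    inside [D]. The case analysis only sorts the three indices. *)
Lemma card_crosses (D : set R) (a h : R) (n : nat) : is_interval D -> 0 <= h ->
  (#|[set j : 'I_n | `[< crosses D (a + h * j%:R) (a + h * j.+1%:R) >]]%SET| <= 2)%N.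
Proof.
move=> itvD h0.
pose x (j : nat) := a + h * j%:R.
have xle i j : (i <= j)%N -> x i <= x j.
  by move=> ij; rewrite lerD2l ler_wpM2l // ler_nat.
have chain (i j k : 'I_n) : (i < j)%N -> (j < k)%N ->
    crosses D (x i) (x i.+1) -> crosses D (x j) (x j.+1) ->
    crosses D (x k) (x k.+1) -> False.
  move=> ij jk [p [_ [/andP[_ pi] _ Dp _]]] [_ [q [_ /andP[jq qj] _ nDq]]].
  move=> [r [_ [/andP[kr _] _ Dr _]]]; apply: nDq; apply: (itvD p r) => //.
  have := xle _ _ ij; have := xle _ _ jk.
  by move=> ? ?; apply/andP; split; lra.
rewrite leqNgt; apply/negP => /card_gt2P [i [j [k []]]].
rewrite !inE => -[Ci Cj Ck] [].
rewrite -!val_eqE /=.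
case: ssrnat.ltngtP => // ij _; case: ssrnat.ltngtP => // jk _; case: ssrnat.ltngtP => // ki _.
- by move: ij jk ki; lia.
- exact: (chain i j k _ _ Ci Cj Ck).
- exact: (chain k i j _ _ Ck Ci Cj).
- exact: (chain i k j _ _ Ci Ck Cj).
- exact: (chain j k i _ _ Cj Ck Ci).
- exact: (chain j i k _ _ Cj Ci Ck).
- exact: (chain k j i _ _ Ck Cj Ci).
- by move: ij jk ki; lia.
Qed.

Lemma measurable_finite_union I : (forall s, is_interval (I s)) ->
  measurable [set x | exists s, I s x].
Proof.
move=> itvI.
have -> : [set x | exists s, I s x] = \bigcup_(s in [set: M]) I s.
  by apply/seteqP; split => x /= [s]; [exists s|exists s].
by apply: fin_bigcup_measurable => // s _; exact: is_interval_measurable.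
Qed.

Local Notation mu := (@lebesgue_measure R).

(** Cells are half-open, hence disjoint, and are added one at a time. An uncrossed cell is contained
    in [U] or disjoint from it, and its left end tells which; on a crossed cell the measure and the
    sampled value both lie between 0 and [h]. *)
Lemma lebesgue_grid_steps (U : set R) (a h : R) (n : nat) :
    measurable U -> 0 <= h ->
  exists2 r : R, mu (U `&` `[a, a + h * n%:R[) = r%:E &
    `|r - \sum_(0 <= j < n) h * (`[< U (a + h * j%:R) >])%:R| <=
    \sum_(0 <= j < n) h * (`[< crosses U (a + h * j%:R) (a + h * j.+1%:R) >])%:R.
Proof.
move=> mU h0; elim: n => [|n [r mur rle]].
  exists 0; first by rewrite mulr0 addr0 set_itvco0 setI0 measure0.
  by rewrite !big_nil subrr normr0.
pose x (j : nat) := a + h * j%:R.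
have xS : x n.+1 = x n + h by rewrite /x -natr1; ring.
have ax : a <= x n by rewrite lerDl mulr_ge0.
have mcell : mu (`[x n, x n.+1[ : set R) = h%:E.
  rewrite lebesgue_measure_itv /= lte_fin xS ltrDl.
  case: ltP => [_|h0']; first by rewrite -EFinD; congr (_%:E); ring.
  by congr (_%:E); lra.
have [t mut tle] : exists2 t : R, mu (U `&` `[x n, x n.+1[) = t%:E &
    `|t - h * (`[< U (x n) >])%:R| <= h * (`[< crosses U (x n) (x n.+1) >])%:R.
  have mUc : measurable (U `&` `[x n, x n.+1[) by exact: measurableI.
  have le_h : (mu (U `&` `[x n, x n.+1[) <= h%:E)%E.
    by rewrite -mcell le_measure ?inE //; exact: subIsetr.
  have fin : mu (U `&` `[x n, x n.+1[) \is a fin_num.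
    by rewrite ge0_fin_numE // (le_lt_trans le_h) // ltry.
  have [t mut] : exists t : R, mu (U `&` `[x n, x n.+1[) = t%:E.
    by exists (fine (mu (U `&` `[x n, x n.+1[))); rewrite fineK.
  exists t => //.
  have t0 : 0 <= t by rewrite -lee_fin -mut measure_ge0.
  have t1 : t <= h by rewrite -lee_fin -mut.
  case: (asboolP (crosses _ _ _)) => [_|nC].
    by rewrite mulr1 ler_norml; case: asboolP => _; rewrite ?mulr1 ?mulr0; apply/andP; split; lra.
  rewrite mulr0 normr_le0.
  (* For [h = 0] the cell is empty and does not contain its left end, so the argument by crossing
     fails; but then [t] is 0. *)
  move: h0; rewrite le_eqVlt => /predU1P[h0|h0].
    by apply/eqP; rewrite -h0 mul0r; lra.
  have xx : x n <= x n < x n.+1 by rewrite lexx xS ltrDl.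
  case: asboolP => [Ux|nUx].
    move: mut; rewrite setIidr ?mcell => [[->]|q /=]; first by rewrite mulr1 subrr.
    rewrite in_itv /= => qx; apply: contrapT => nUq.
    by apply: nC; exists (x n), q.
  move: mut; rewrite (_ : _ `&` _ = set0) ?measure0 => [[<-]|].
    by rewrite mulr0 subrr.
  apply/seteqP; split => // q [Uq] /=; rewrite in_itv /= => qx.
  by apply: nC; exists q, (x n).
exists (r + t).
  rewrite EFinD -mur -mut -measureU; last 3 first.
  - exact: measurableI.
  - exact: measurableI.
  - apply/seteqP; split => // q [[_]] /=; rewrite !in_itv /= => /andP[_ q1].
    by move=> [_ /andP[q2 _]]; have := lt_le_trans q1 q2; rewrite ltxx.
  rewrite -setIUr; congr (mu (_ `&` _)).
  apply/seteqP; split => q /=; rewrite !in_itv /= -/(x n) -/(x n.+1) ?xS.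
    by move=> /andP[aq qx]; case: (ltP q (x n)) => ?; [left|right]; apply/andP.
  by case=> /andP[aq qx]; apply/andP; split; lra.
rewrite !big_nat_recr //= -/(x n) -/(x n.+1).
move: rle tle; rewrite !ler_norml => /andP[? ?] /andP[? ?].
by apply/andP; split; lra.
Qed.

Definition grid_point (a b : R) (B : nat) (w : seq bool) : R :=
  a + (b - a) / 2 ^+ B * (nat_of_bits w)%:R.

Lemma grid_point_itv a b B w : a <= b -> size w = B ->
  a <= grid_point a b B w <= b.
Proof.
move=> ab sw; rewrite /grid_point lerDl.
have p0 : 0 < 2 ^+ B :> R by rewrite exprn_gt0.
have ba : 0 <= b - a by lra.
rewrite mulr_ge0 ?divr_ge0 ?exprn_ge0 //=.
rewrite -mulrA -lerBrDl ler_piMr // mulrC ler_pdivrMr // mul1r.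
by rewrite -natrX ler_nat -sw ltnW // nat_of_bits_lt.
Qed.

Lemma lebesgue_grid1 I (a b : R) (B : nat) :
    (forall s, is_interval (I s)) -> a <= b ->
    (forall x, (exists s, I s x) -> a <= x <= b) ->
  exists2 r, mu [set x | exists s, I s x] = r%:E &
    `|r - (b - a) * coin_mean B (fun w =>
            (`[< exists s, I s (grid_point a b B w) >])%:R)| <=
    (b - a) * (2 * #|M|)%:R / 2 ^+ B.
Proof.
move=> itvI ab Uab; set U := [set x | _].
have mU : measurable U by exact: measurable_finite_union.
have p0 : 0 < 2 ^+ B :> R by rewrite exprn_gt0.
pose h := (b - a) / 2 ^+ B.
have h0 : 0 <= h by rewrite divr_ge0 ?subr_ge0 // ltW.
have hb : a + h * (2 ^ B)%:R = b.
  by rewrite /h natrX divfK ?gt_eqF //; ring.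
have [r mur rle] := lebesgue_grid_steps a (2 ^ B) mU h0.
exists r.
  (* The half-open cells miss the point [b], which is a null set. *)
  rewrite -mur hb [in LHS](_ : U = (U `&` `[a, b[) `|` (U `&` [set b])); last first.
    apply/seteqP; split => x; last by case=> -[].
    move=> Ux; have := Uab _ Ux.
    move=> /andP[ax]; rewrite le_eqVlt => /predU1P[xb|xb]; [right|left] => //.
    by split=> //=; rewrite in_itv /= ax.
  have mb : measurable (U `&` [set b]) by apply: measurableI => //; exact: measurable_set1.
  rewrite measureU //; last 2 first.
  - exact: measurableI.
  - apply/seteqP; split => // x [[_ /=]]; rewrite in_itv /= => /andP[_ xb] [_ xb'].
    by rewrite xb' ltxx in xb.
  rewrite [X in (_ + X)%E](_ : _ = 0%E); last first.
    apply/eqP; rewrite eq_le measure_ge0 andbT -(lebesgue_measure_set1 b).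
    by rewrite le_measure ?inE //; exact: subIsetr.
  by rewrite adde0.
have -> : (b - a) * coin_mean B (fun w => (`[< exists s, I s (grid_point a b B w) >])%:R)
    = \sum_(0 <= j < 2 ^ B) h * (`[< U (a + h * j%:R) >])%:R.
  rewrite (@coin_mean_nat R B (fun j => (`[< exists s, I s (a + h * j%:R) >])%:R)).
  by rewrite -mulr_sumr /h; ring.
apply: (le_trans rle); rewrite -mulr_sumr.
rewrite [leRHS](_ : _ = h * (2 * #|M|)%:R); last by rewrite /h; ring.
rewrite ler_wpM2l // big_mkord -natr_sum ler_nat.
(* A cell crossed by the union is crossed by the interval containing its inside point, since the
   outside point avoids every interval. Crossed cells are then counted interval by interval. *)
apply: (@leq_trans (\sum_(j < 2 ^ B) \sum_(s : M)
    `[< crosses (I s) (a + h * j%:R) (a + h * j.+1%:R) >])%N).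
  apply: leq_sum => j _; case: asboolP => // -[p [q [px qx [s Isp] nUq]]].
  have crs : crosses (I s) (a + h * j%:R) (a + h * j.+1%:R).
    by exists p, q; split => //; apply: contra_not nUq => Isq; exists s.
  by rewrite (bigD1 s) //= (asboolT crs).
rewrite exchange_big /= mulnC -sum_nat_const.
apply: leq_sum => s _.
apply: leq_trans (card_crosses a (2 ^ B) (itvI s) h0).
rewrite -sum1_card [leqRHS]big_mkcond /=.
by apply: leq_sum => j _; rewrite inE; case: ifP => // ->.
Qed.
End Grid1.

(** No measurability is required, because the integral of a nonnegative function is a supremum over
    the simple functions below it. *)
Lemma ge0_le_integralT d (T : measurableType d) (R : realType)
    (m : {measure set T -> \bar R}) (f g : T -> \bar R) :
  (forall x, 0 <= f x)%E -> (forall x, f x <= g x)%E ->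
  (\int[m]_x f x <= \int[m]_x g x)%E.
Proof.
move=> f0 fg.
have g0 x : (0 <= g x)%E by exact: le_trans (fg x).
rewrite !ge0_integralTE //.
apply: le_ereal_sup => _ /= [h hf <-]; exists h => // x.
exact: le_trans (fg x).
Qed.

(** * Integrals of possibly non-measurable functions close to a grid average *)

Section Sandwich.
Variable R : realType.
Local Notation mu := (@lebesgue_measure R).

Lemma coin_mean_indic_ge0 n (U : seq bool -> set R) (x : R) :
  0 <= coin_mean n (fun w => \1_(U w) x : R).
Proof. by apply: coin_mean_ge0 => w _; rewrite indicE. Qed.

Lemma measurable_coin_mean n (U : seq bool -> set R) :
  (forall w, size w = n -> measurable (U w)) ->
  measurable_fun setT (fun x => coin_mean n (fun w => \1_(U w) x : R)).
Proof.
elim: n U => [|n IHn] U mU /=; first by apply: measurable_indic; exact: mU.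
apply: measurable_funM => //; apply: measurable_funD;
  by apply: IHn => w sw; apply: mU; rewrite /= sw.
Qed.

Lemma integral_coin_mean n (U : seq bool -> set R) (m : seq bool -> R) :
    (forall w, size w = n -> measurable (U w)) ->
    (forall w, size w = n -> mu (U w) = (m w)%:E) ->
  (\int[mu]_x (coin_mean n (fun w => \1_(U w) x : R))%:E)%E = (coin_mean n m)%:E.
Proof.
elim: n U m => [|n IHn] U m mU muU /=.
  by rewrite integral_indic; [rewrite setIT; exact: muU|by []|exact: mU].
have mU' b w : size w = n -> measurable (U (b :: w)).
  by move=> sw; apply: mU; rewrite /= sw.
have muU' b w : size w = n -> mu (U (b :: w)) = (m (b :: w))%:E.
  by move=> sw; apply: muU; rewrite /= sw.
under eq_integral do rewrite mulrC EFinM EFinD.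
rewrite ge0_integralZl_EFin //; last 2 first.
- by move=> x _; rewrite -EFinD lee_fin addr_ge0 // coin_mean_indic_ge0.
- apply/measurable_EFinP; apply: measurable_funD;
  by apply: measurable_coin_mean; exact: mU'.
rewrite ge0_integralD //; last 4 first.
- by move=> x _; rewrite lee_fin coin_mean_indic_ge0.
- by apply/measurable_EFinP; apply: measurable_coin_mean; exact: mU'.
- by move=> x _; rewrite lee_fin coin_mean_indic_ge0.
- by apply/measurable_EFinP; apply: measurable_coin_mean; exact: mU'.
rewrite (IHn _ _ (mU' true) (muU' true)) (IHn _ _ (mU' false) (muU' false)).
by rewrite -EFinD -EFinM mulrC.
Qed.

(** [F] will be the volume of a section. Additivity of the integral is applied only to measurable
    functions built from the average of indicators; [F] enters through monotonicity alone. *)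
Lemma integral_sandwich n (U : seq bool -> set R) (m : seq bool -> R)
    (F : R -> R) (a b c e : R) :
    a <= b -> 0 <= c -> 0 <= e ->
    (forall w, size w = n -> measurable (U w)) ->
    (forall w, size w = n -> mu (U w) = (m w)%:E) ->
    (forall w x, size w = n -> U w x -> a <= x <= b) ->
    (forall x, 0 <= F x) -> (forall x, ~~ (a <= x <= b) -> F x = 0) ->
    (forall x, a <= x <= b ->
       `|F x - c * coin_mean n (fun w => \1_(U w) x : R)| <= e) ->
  exists2 r, (\int[mu]_x (F x)%:E)%E = r%:E &
    `|r - c * coin_mean n m| <= e * (b - a).
Proof.
move=> ab c0 e0 mU muU Uab F0 Fout Fin.
pose h x := c * coin_mean n (fun w => \1_(U w) x : R).
pose D : set R := `[a, b].
have mD : measurable D by exact: measurable_itv.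
have muD : mu D = (b - a)%:E.
  rewrite lebesgue_measure_itv /= lte_fin.
  by case: ltP => [//|ba]; congr (_%:E); lra.
have h0 x : 0 <= h x by rewrite mulr_ge0 // coin_mean_indic_ge0.
have mh : measurable_fun setT h.
  by apply: measurable_funM => //; exact: measurable_coin_mean.
have inth : (\int[mu]_x (h x)%:E)%E = (c * coin_mean n m)%:E.
  under eq_integral do rewrite EFinM.
  rewrite ge0_integralZl_EFin //; last 2 first.
  - by move=> x _; rewrite lee_fin coin_mean_indic_ge0.
  - by apply/measurable_EFinP; exact: measurable_coin_mean.
  by rewrite (integral_coin_mean mU muU).
have mDe : measurable_fun setT (fun x => e * \1_D x : R).
  by apply: measurable_funM => //; exact: measurable_indic.
have De0 x : 0 <= e * \1_D x by rewrite mulr_ge0 // indicE.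
have addD (f : R -> R) : (forall x, 0 <= f x) -> measurable_fun setT f ->
    (\int[mu]_x (f x + e * \1_D x)%:E)%E =
    (\int[mu]_x (f x)%:E + (e * (b - a))%:E)%E.
  move=> f0 mf; under eq_integral do rewrite EFinD.
  rewrite ge0_integralD //; last 4 first.
  - by move=> x _; rewrite lee_fin.
  - exact/measurable_EFinP.
  - by move=> x _; rewrite lee_fin.
  - exact/measurable_EFinP.
  congr (_ + _)%E; under eq_integral do rewrite EFinM.
  rewrite ge0_integralZl_EFin //; last first.
    by apply/measurable_EFinP; exact: measurable_indic.
  rewrite integral_indic // setIT [RHS]EFinM; congr (_ * _)%E; exact: muD.
have hout x : ~~ (a <= x <= b) -> h x = 0.
  move=> nx; rewrite /h (_ : coin_mean _ _ = 0) ?mulr0 //.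
  rewrite -[RHS](coin_mean_cst n); apply: eq_coin_mean => w sw.
  rewrite indicE memNset // => Uw.
  by rewrite (Uab _ _ sw Uw) in nx.
have D1 x : a <= x <= b -> \1_D x = 1 :> R.
  by move=> xab; rewrite indicE mem_set //= /D /= in_itv.
have upper : (\int[mu]_x (F x)%:E <= (c * coin_mean n m + e * (b - a))%:E)%E.
  rewrite EFinD -inth -addD //; apply: ge0_le_integralT => x; rewrite lee_fin //.
  have [xab|nx] := boolP (a <= x <= b).
    by have := Fin _ xab; rewrite D1 // ler_norml -/(h x) => /andP[_ ?]; lra.
  by rewrite Fout // addr_ge0.
have lower : ((c * coin_mean n m)%:E <= \int[mu]_x (F x)%:E + (e * (b - a))%:E)%E.
  (* The integral of [F + e * \1_D] cannot be split without measurability of [F]. The measurable [g]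
     lies below [F], and [g + e * \1_D] lies above [h]. *)
  pose g x := Num.max (h x - e) 0.
  have g0 x : 0 <= g x by rewrite le_max lexx orbT.
  apply: (@le_trans _ _ (\int[mu]_x (g x)%:E + (e * (b - a))%:E)%E).
    rewrite -inth -addD //; last first.
      by apply: measurable_maxr => //; exact: measurable_funB.
    apply: ge0_le_integralT => x; rewrite lee_fin //.
    have [xab|nx] := boolP (a <= x <= b); last by rewrite hout // addr_ge0.
    by rewrite D1 // mulr1 -lerBlDr le_max lexx.
  rewrite leeD2r //; apply: ge0_le_integralT => x; rewrite lee_fin //.
  have [xab|nx] := boolP (a <= x <= b); last by rewrite /g hout // Fout // ge_max; lra.
  by have := Fin _ xab; rewrite ler_norml -/(h x) /g ge_max F0 => /andP[? ?]; lra.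
have I0 : (0 <= \int[mu]_x (F x)%:E)%E by apply: integral_ge0 => x _; rewrite lee_fin.
have fin : (\int[mu]_x (F x)%:E)%E \is a fin_num.
  by rewrite ge0_fin_numE // (le_lt_trans upper) // ltry.
exists (fine (\int[mu]_x (F x)%:E)%E); first by rewrite fineK.
move: lower upper; rewrite -(fineK fin) -EFinD !lee_fin => lower upper.
rewrite /= ler_norml; apply/andP; split; lra.
Qed.
End Sandwich.

Section Grid.
Variables (R : realType) (M : finType).

Definition convex_pred (k : nat) (T : seq R -> Prop) : Prop :=
  forall (x y z : seq R) (t : R), size x = k -> size y = k -> size z = k ->
    0 <= t <= 1 ->
    (forall i, nth 0 z i = (1 - t) * nth 0 x i + t * nth 0 y i) ->
    T x -> T y -> T z.

Definition in_box (dom : seq (R * R)) (x : seq R) : bool :=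
  all (fun p => p.1.1 <= p.2 <= p.1.2) (zip dom x).

Definition box_volume (dom : seq (R * R)) : R := \prod_(d <- dom) (d.2 - d.1).

Fixpoint grid_tuple (B : nat) (dom : seq (R * R)) (w : seq bool) : seq R :=
  if dom is d :: dom' then
    grid_point d.1 d.2 B (take B w) :: grid_tuple B dom' (drop B w)
  else [::].

Lemma size_grid_tuple B dom w : size (grid_tuple B dom w) = size dom.
Proof. by elim: dom w => //= d dom IH w; rewrite IH. Qed.

Lemma grid_tuple_in_box B dom w : all (fun d => d.1 <= d.2) dom ->
  (size dom * B <= size w)%N -> in_box dom (grid_tuple B dom w).
Proof.
elim: dom w => //= d dom IH w /andP[d12 dom12]; rewrite mulSn => sw.
rewrite /in_box /= grid_point_itv //=.
  by apply: IH => //; rewrite size_drop leq_subRL // (leq_trans (leq_addr _ _) sw).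
by rewrite size_takel // (leq_trans (leq_addr _ _) sw).
Qed.

Lemma box_volume_ge0 dom : all (fun d => d.1 <= d.2) dom -> 0 <= box_volume dom.
Proof.
move=> /allP dom12; rewrite /box_volume big_seq; apply: prodr_ge0 => d /dom12.
by rewrite subr_ge0.
Qed.

Lemma convex_pred_interval k (T : seq R -> Prop) (u : seq R) :
  convex_pred k.+1 T -> size u = k -> is_interval [set x | T (x :: u)].
Proof.
move=> cT su x y /= Tx Ty z /andP[xz zy].
have [xy|xy] := eqVneq x y.
  by have -> : z = x by lra.
have xy' : x < y by rewrite lt_neqAle xy (le_trans xz).
apply: (cT (x :: u) (y :: u) _ ((z - x) / (y - x))); rewrite /= ?su //.
  by rewrite divr_ge0 ?subr_ge0 ?(ltW xy') //= ler_pdivrMr ?subr_gt0 // mul1r lerD2r.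
have yx : y - x != 0 by rewrite subr_eq0 gt_eqF.
case=> [|i] /=; first by field.
by rewrite -mulrDl subrK mul1r.
Qed.

Lemma lebesgue_set0 k : @lebesgue R k set0 = 0%E.
Proof.
elim: k => [|k IHk] /=; first by rewrite /dirac indicE memNset.
rewrite /product_measure1 (_ : (fun x => _) = cst 0%E) ?integral0 //.
apply/funext => x /=; rewrite -[RHS]IHk; congr (lebesgue _).
by rewrite -subset0 => y; rewrite /xsection /= inE.
Qed.

Lemma lebesgue_ge0 k (A : set (k.-tuple (measurableTypeR R))) : (0 <= lebesgue A)%E.
Proof.
elim: k A => [|k IHk] A /=; first exact: measure_ge0.
by apply: integral_ge0 => x _ /=; exact: IHk.
Qed.

(** Sections of convex sets are convex, so the induction hypothesis replaces each section volume by
    a grid average over the other coordinates. Once their coins are fixed, what remains in the first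
    coordinate is a finite union of intervals, covered by [lebesgue_grid1]. Each coordinate
    contributes the same relative error. *)
Lemma lebesgue_grid (B k : nat) (dom : seq (R * R)) (T : M -> seq R -> Prop) :
    size dom = k -> all (fun d => d.1 <= d.2) dom ->
    (forall s, convex_pred k (T s)) ->
    (forall x, size x = k -> (exists s, T s x) -> in_box dom x) ->
  exists2 r, lebesgue [set x : k.-tuple R | exists s, T s x] = r%:E &
    `|r - box_volume dom * coin_mean (k * B) (fun w =>
            (`[< exists s, T s (grid_tuple B dom w) >])%:R)| <=
    box_volume dom * (k * (2 * #|M|))%:R / 2 ^+ B.
Proof.
elim: k dom T => [|k IHk] [|d dom] T //=.
  move=> _ _ _ _; rewrite /dirac indicE.
  exists (`[< exists s, T s [::] >])%:R; last first.
    by rewrite /box_volume big_nil mul1r subrr normr0 mul0n mulr0 mul0r.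
  case: asboolP => [Ts|nTs]; first by rewrite mem_set.
  by rewrite memNset.
case=> sdom /andP[d12 dom12] cT Tbox.
have V0 := box_volume_ge0 dom12.
have p0 : 0 < 2 ^+ B :> R by rewrite exprn_gt0.
set V := box_volume dom.
set e := V * (k * (2 * #|M|))%:R / 2 ^+ B.
have e0 : 0 <= e by rewrite divr_ge0 ?mulr_ge0 // ltW.
pose sec x := [set y : k.-tuple R | exists s, T s (x :: y)].
pose U w := [set x | exists s, T s (x :: grid_tuple B dom w)].
have itvU w s : is_interval [set x | T s (x :: grid_tuple B dom w)].
  by apply: (@convex_pred_interval k) => //; rewrite size_grid_tuple.
have Uab w x : U w x -> d.1 <= x <= d.2.
  by move/Tbox; rewrite /= size_grid_tuple sdom => /(_ erefl) /andP[].
(* The average over the remaining coordinates is read as a function of [x]: an average of indicators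
   of the sets [U w], as [integral_sandwich] expects. *)
have IHx x : exists r, lebesgue (sec x) = r%:E /\
    `|r - V * coin_mean (k * B) (fun w => \1_(U w) x : R)| <= e.
  have [||r rE rle] := IHk dom (fun s y => T s (x :: y)) sdom dom12.
  - move=> s y1 y2 z t s1 s2 sz t01 zE; apply: (cT s (x :: y1) (x :: y2) _ t);
      rewrite /= ?s1 ?s2 ?sz //.
    by case=> [|i] /=; [ring|exact: zE].
  - by move=> y sy Ty; have /andP[] := Tbox (x :: y) (congr1 S sy) Ty.
  by exists r.
have [F FE] := choice IHx.
have mE w : exists t, lebesgue_measure (U w) = t%:E /\
    `|t - (d.2 - d.1) * coin_mean B (fun v =>
        (`[< U w (grid_point d.1 d.2 B v) >])%:R)| <=
    (d.2 - d.1) * (2 * #|M|)%:R / 2 ^+ B.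
  have [t tE tle] := lebesgue_grid1 B (itvU w) d12 (Uab w).
  by exists t.
have [m {}mE] := choice mE.
have mU w : measurable (U w) by apply: measurable_finite_union (itvU w).
have F0 x : 0 <= F x by rewrite -lee_fin -(FE x).1 lebesgue_ge0.
have Fout x : ~~ (d.1 <= x <= d.2) -> F x = 0.
  move=> nx; apply: EFin_inj; rewrite -(FE x).1 -[RHS](lebesgue_set0 k).
  congr (lebesgue _); apply/seteqP; split => // y Ty.
  have := Tbox (x :: y); rewrite /= size_tuple => /(_ erefl Ty).
  by rewrite /in_box /= (negbTE nx).
have [r rE rle] := integral_sandwich (n := k * B) d12 V0 e0
  (fun w _ => mU w) (fun w _ => (mE w).1) (fun w x _ => Uab w x) F0 Fout
  (fun x _ => (FE x).2).
exists r.
  rewrite -rE /product_measure1; apply: eq_integral => x _ /=.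
  rewrite -(FE x).1; congr (lebesgue _); apply/seteqP.
  by split => y; rewrite /xsection /= inE.
have -> : coin_mean (k.+1 * B) (fun w =>
      (`[< exists s, T s (grid_point d.1 d.2 B (take B w) ::
                            grid_tuple B dom (drop B w)) >])%:R) =
    coin_mean (k * B) (fun w => coin_mean B (fun v =>
      (`[< U w (grid_point d.1 d.2 B v) >])%:R)) :> R.
  rewrite mulSn coin_mean_cat coin_mean_exchange; apply: eq_coin_mean => w _.
  by apply: eq_coin_mean => v sv; rewrite take_size_cat // drop_size_cat.
rewrite /box_volume big_cons -/(box_volume dom) -/V.
have := @coin_mean_le_dist R (k * B) m _ _ (fun w _ => (mE w).2).
rewrite coin_meanZ.
set c := coin_mean _ (fun w => coin_mean _ _) => mle.
have {}mle : `|V * coin_mean (k * B) m - V * ((d.2 - d.1) * c)| <=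
    V * ((d.2 - d.1) * (2 * #|M|)%:R / 2 ^+ B).
  by rewrite -mulrBr normrM (ger0_norm V0) ler_wpM2l.
have -> : (d.2 - d.1) * V * (k.+1 * (2 * #|M|))%:R / 2 ^+ B =
    e * (d.2 - d.1) + V * ((d.2 - d.1) * (2 * #|M|)%:R / 2 ^+ B).
  by rewrite /e mulSn natrD; ring.
rewrite [_ * V]mulrC -[V * _ * c]mulrA.
move: rle mle; rewrite -/V !ler_norml => /andP[? ?] /andP[? ?].
by apply/andP; split; lra.
Qed.
End Grid.

(** * The set of models as a union of convex sets *)

Fixpoint atoms (f : Defs.form) : seq (term * term) :=
  match f with
  | FLe t1 t2 | FLt t1 t2 | FEq t1 t2 => [:: (t1, t2)]
  | FNot f1 => atoms f1
  | FAnd f1 f2 | FOr f1 f2 => atoms f1 ++ atoms f2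
  end.

Section SignVectors.
Variable R : realType.
Implicit Types v : nat -> R.

(* [None] stands for equality, [Some true] for < and [Some false] for >. *)
Definition atom_sign v (a : term * term) : option bool :=
  let x := teval v a.1 in let y := teval v a.2 in
  if x == y then None else Some (x < y).

Definition sign_vector v (f : Defs.form) : (size (atoms f)).-tuple (option bool) :=
  [tuple of [seq atom_sign v a | a <- in_tuple (atoms f)]].

Lemma feval_sign_vector v v' f :
  [seq atom_sign v a | a <- atoms f] = [seq atom_sign v' a | a <- atoms f] ->
  feval v f = feval v' f.
Proof.
elim: f => [t1 t2|t1 t2|t1 t2|f IHf|f1 IH1 f2 IH2|f1 IH1 f2 IH2] /=.
- by case; rewrite /atom_sign /= !le_eqVlt; do 2![case: eqP => _] => // -[->].
- case; rewrite /atom_sign /=.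
  by case: eqP => [->|_]; case: eqP => [->|_]; rewrite ?ltxx // => -[->].
- by case; rewrite /atom_sign /=; do 2![case: eqP => _].
- by move/IHf->.
- rewrite !map_cat => /eqP; rewrite eqseq_cat ?size_map // => /andP[/eqP e1 /eqP e2].
  by rewrite IH1 ?IH2.
- rewrite !map_cat => /eqP; rewrite eqseq_cat ?size_map // => /andP[/eqP e1 /eqP e2].
  by rewrite IH1 ?IH2.
Qed.

Lemma teval_convex (v1 v2 v : nat -> R) (t : R) (tm : term) :
  (forall i, v i = (1 - t) * v1 i + t * v2 i) ->
  teval v tm = (1 - t) * teval v1 tm + t * teval v2 tm.
Proof.
move=> vE; elim: tm => [i|q|t1 IH1 t2 IH2|q t1 IH1] /=; rewrite ?vE ?IH1 ?IH2 //;
  by ring.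
Qed.

Lemma convex_comb_lt (t x1 y1 x2 y2 : R) : 0 <= t <= 1 -> x1 < y1 -> x2 < y2 ->
  (1 - t) * x1 + t * x2 < (1 - t) * y1 + t * y2.
Proof.
move=> /andP[t0 t1] xy1 xy2; have [->|tn0] := eqVneq t 0; first by lra.
have tp : 0 < t by rewrite lt_def tn0.
by rewrite ler_ltD ?ltr_pM2l // ler_wpM2l ?subr_ge0 // ltW.
Qed.

(** Each sign is a strict linear inequality or a linear equation in the valuation, and both persist
    under convex combinations. *)
Lemma atom_sign_convex (v1 v2 v : nat -> R) (t : R) (a : term * term) :
    0 <= t <= 1 -> (forall i, v i = (1 - t) * v1 i + t * v2 i) ->
  atom_sign v1 a = atom_sign v2 a -> atom_sign v a = atom_sign v1 a.
Proof.
move=> t01 vE; rewrite /atom_sign !(teval_convex _ vE).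
move: (teval v1 a.1) (teval v1 a.2) (teval v2 a.1) (teval v2 a.2) => x1 y1 x2 y2.
case: (ltgtP x1 y1) => xy1; case: (ltgtP x2 y2) => xy2 //= _.
- have lt : (1 - t) * x1 + t * x2 < (1 - t) * y1 + t * y2 by exact: convex_comb_lt.
  by rewrite lt lt_eqF.
- have lt : (1 - t) * y1 + t * y2 < (1 - t) * x1 + t * x2 by exact: convex_comb_lt.
  by rewrite gt_eqF // ltNge ltW.
- by rewrite xy1 xy2 eqxx.
Qed.

End SignVectors.

Section Models.
Variables (R : realType) (phi : lra).
Let k := lra_arity phi.
Let m := lra_nex phi.
Let f := lra_matrix phi.

Definition real_dom : seq (R * R) :=
  [seq (Qval R d.1, Qval R d.2) | d <- lra_dom phi].

Definition is_model (x : seq R) : Prop :=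
  in_box real_dom x /\ exists2 y : seq R, size y = m & feval (nth 0 (x ++ y)) f.

(** The sign vector also involves the quantified variables and is fixed before they are projected
    away. Cells may therefore overlap; only their number and convexity matter. *)
Let cell (s : (size (atoms f)).-tuple (option bool)) (x : seq R) : Prop :=
  in_box real_dom x /\ exists y : seq R, [/\ size y = m,
    sign_vector (nth 0 (x ++ y)) f = s & feval (nth 0 (x ++ y)) f].

Let cellP x : (exists s, cell s x) <-> is_model x.
Proof.
split=> [[s [xb [y [sy _ fy]]]]|[xb [y sy fy]]]; first by split=> //; exists y.
by exists (sign_vector (nth 0 (x ++ y)) f); split => //; exists y.
Qed.

Lemma Qval_le (q1 q2 : Q) : (Qval rat q1 <= Qval rat q2) = (Qval R q1 <= Qval R q2).
Proof.
rewrite -(ler_rat R) /Qval !fmorph_div /= !ratr_int //.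
Qed.

Lemma in_box_nth (dom : seq (R * R)) x : size x = size dom ->
  in_box dom x <-> forall i, (i < size dom)%N ->
    (nth (0, 0) dom i).1 <= nth 0 x i <= (nth (0, 0) dom i).2.
Proof.
move=> sx; rewrite /in_box; split.
  move=> /(all_nthP ((0, 0), 0)) + i idom; move=> /(_ i).
  by rewrite size_zip sx minnn => /(_ idom); rewrite nth_zip.
move=> H; apply/(all_nthP ((0, 0), 0)) => i; rewrite size_zip sx minnn => idom.
by rewrite nth_zip //=; exact: H.
Qed.

Lemma in_box_convex (dom : seq (R * R)) : convex_pred (size dom) (in_box dom).
Proof.
move=> x y z t sx sy sz /andP[t0 t1] zE.
move=> /(in_box_nth sx) xb /(in_box_nth sy) yb; apply/(in_box_nth sz) => i idom.
have /andP[? ?] := xb i idom; have /andP[? ?] := yb i idom.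
by rewrite zE; apply/andP; split; nra.
Qed.

Let cell_convex s : convex_pred k (cell s).
Proof.
move=> x1 x2 x t s1 s2 sx t01 xE [b1 [y1 [sy1 sg1 f1]]] [b2 [y2 [sy2 sg2 f2]]].
split.
  by apply: (in_box_convex _ _ _ t01 xE); rewrite ?size_map.
pose y := mkseq (fun i => (1 - t) * nth 0 y1 i + t * nth 0 y2 i) m.
have vE i : nth 0 (x ++ y) i = (1 - t) * nth 0 (x1 ++ y1) i + t * nth 0 (x2 ++ y2) i.
  rewrite !nth_cat s1 s2 sx; case: ltnP => // ki.
  have [im|im] := ltnP (i - k) m; first by rewrite nth_mkseq.
  by rewrite !nth_default ?size_mkseq ?sy1 ?sy2 //; ring.
have sgE : sign_vector (nth 0 (x ++ y)) f = s.
  rewrite -sg1; apply: val_inj => /=.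
  have /(congr1 val) /= := etrans sg1 (esym sg2).
  by elim: (atoms f) => //= a l IHl [/(atom_sign_convex t01 vE) -> /IHl ->].
exists y; split; rewrite ?size_mkseq //.
rewrite (@feval_sign_vector _ _ (nth 0 (x1 ++ y1))) //.
by have /(congr1 val) := etrans sgE (esym sg1).
Qed.

Lemma real_dom_le : lra_wf phi -> all (fun d => d.1 <= d.2) real_dom.
Proof.
by case/andP => dom12 _; rewrite all_map; apply: sub_all dom12 => d; rewrite /= Qval_le.
Qed.

Lemma size_real_dom : size real_dom = k. Proof. exact: size_map. Qed.

Lemma lra_modelsE : @lra_models R phi = [set x | is_model x].
Proof.
have boxE (x : (lra_arity phi).-tuple R) : in_box real_dom x <->
    forall i : 'I_(lra_arity phi), let d := tnth (in_tuple (lra_dom phi)) i in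
      Qval R d.1 <= tnth x i <= Qval R d.2.
  pose q0 : Q * Q := (QArith_base.Qmake Z0 xH, QArith_base.Qmake Z0 xH).
  rewrite in_box_nth ?size_tuple ?size_real_dom //; split.
    move=> H i; have := H i (ltn_ord i).
    by rewrite /= (nth_map q0) // !(tnth_nth q0) !(tnth_nth 0).
  move=> H i ik; have := H (Ordinal ik).
  by rewrite /= (nth_map q0) // !(tnth_nth q0) !(tnth_nth 0).
apply/seteqP; split => x [xb].
  by move=> [y fy]; split; [exact/boxE|exists y; rewrite ?size_tuple].
move=> [y sy fy]; split; first exact/boxE.
have sy' : size y == lra_nex phi by exact/eqP.
by exists (Tuple sy').
Qed.

Lemma model_count_grid (B : nat) : lra_wf phi ->
  `|model_count R phi - lra_bound R phi * coin_mean (k * B) (fun w =>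
      (`[< is_model (grid_tuple B real_dom w) >])%:R)| <=
  lra_bound R phi * (k * (2 * 3 ^ size (atoms f)))%:R / 2 ^+ B.
Proof.
move=> wf; have dom12 := real_dom_le wf.
have [r rE rle] := lebesgue_grid B size_real_dom dom12 cell_convex
  (fun x _ => fun Hs => ((cellP x).1 Hs).1).
have mE : @lra_models R phi = [set x : k.-tuple R | exists s, cell s x].
  by rewrite lra_modelsE; apply/seteqP; split=> x /cellP.
rewrite /model_count mE.
rewrite rE /=.
have -> : lra_bound R phi = box_volume real_dom.
  by rewrite /lra_bound /box_volume big_map.
move: rle; rewrite card_tuple card_option card_bool.
by under eq_coin_mean => w _ do rewrite (propext (cellP _)).
Qed.

End Models.

(** * Independent samples *)

Section Sampling.
Variables (R : realFieldType) (b : nat) (g : seq bool -> R).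

(** A binary tree of halvings over consecutive blocks of [b] coins: it mirrors [sample_term], and
    independence is only ever needed between two halves. *)
Fixpoint sample_mean (j : nat) (w : seq bool) : R :=
  if j is j'.+1 then
    (sample_mean j' w + sample_mean j' (drop (2 ^ j' * b) w)) / 2
  else g (take b w).

Let mu := coin_mean b g.

Lemma sample_mean_cat j u v : size u = (2 ^ j * b)%N ->
  sample_mean j (u ++ v) = sample_mean j u.
Proof.
elim: j u v => [|j IHj] u v /= su.
  by rewrite mul1n in su; rewrite take_size_cat // take_oversize // su.
move: su; rewrite expnS mul2n -addnn mulnDl => su.
have s1 : size (take (2 ^ j * b) u) = (2 ^ j * b)%N.
  by rewrite size_takel // su leq_addr.
have s2 : size (drop (2 ^ j * b) u) = (2 ^ j * b)%N by rewrite size_drop su addnK.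
rewrite -[u](cat_take_drop (2 ^ j * b)); move: s1 s2.
move: (take _ u) (drop _ u) => u1 u2 s1 s2.
by rewrite -catA !drop_size_cat // !IHj.
Qed.

Lemma coin_mean_sample j (h : R -> R -> R) :
  coin_mean (2 ^ j.+1 * b) (fun w =>
    h (sample_mean j w) (sample_mean j (drop (2 ^ j * b) w))) =
  coin_mean (2 ^ j * b) (fun u => coin_mean (2 ^ j * b) (fun v =>
    h (sample_mean j u) (sample_mean j v))).
Proof.
rewrite expnS mul2n -addnn mulnDl coin_mean_cat.
apply: eq_coin_mean => u su; apply: eq_coin_mean => v _.
by rewrite sample_mean_cat // drop_size_cat.
Qed.

Lemma sample_mean_mean j : coin_mean (2 ^ j * b) (sample_mean j) = mu.
Proof.
elim: j => [|j IHj].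
  by rewrite mul1n; apply: eq_coin_mean => w sw; rewrite /= take_oversize // sw.
rewrite [LHS](coin_mean_sample j (fun x y => (x + y) / 2)).
rewrite (eq_coin_mean (g := fun u => (1 / 2) * (sample_mean j u + mu))); last first.
  move=> u _; rewrite (eq_coin_mean (g := fun v => (1 / 2) * (sample_mean j u + sample_mean j v))).
    by rewrite coin_meanZ coin_meanD coin_mean_cst IHj.
  by move=> v _; field.
by rewrite coin_meanZ coin_meanD coin_mean_cst IHj; field.
Qed.

(** The two halves use disjoint coins, so the cross term averages to 0 and each level halves the
    variance. *)
Lemma sample_mean_variance j :
  coin_mean (2 ^ j * b) (fun w => (sample_mean j w - mu) ^+ 2) =
  coin_mean b (fun w => (g w - mu) ^+ 2) / 2 ^+ j.
Proof.
elim: j => [|j IHj].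
  rewrite expr0 divr1 mul1n; apply: eq_coin_mean => w sw.
  by rewrite /= take_oversize // sw.
rewrite [LHS](coin_mean_sample j (fun x y => ((x + y) / 2 - mu) ^+ 2)).
rewrite (eq_coin_mean (g := fun u => (1 / 4) * ((sample_mean j u - mu) ^+ 2 +
    coin_mean (2 ^ j * b) (fun w => (sample_mean j w - mu) ^+ 2)))); last first.
  move=> u _; set x := sample_mean j u.
  rewrite (eq_coin_mean (g := fun v => (1 / 4) * (((x - mu) ^+ 2 +
    2 * (x - mu) * (sample_mean j v - mu)) + (sample_mean j v - mu) ^+ 2))).
    rewrite coin_meanZ !coin_meanD coin_mean_cst coin_meanZ coin_meanB.
    by rewrite coin_mean_cst sample_mean_mean subrr mulr0 addr0.
  by move=> v _; field.
rewrite coin_meanZ coin_meanD coin_mean_cst IHj exprS.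
by field; rewrite expf_neq0.
Qed.

(** Pointwise, the indicator of a small deviation is at least 1 minus the squared ratio of the
    deviation to [t]. Averaging leaves the variance, at most 1 because the values and their mean lie
    in [0, 1]. *)
Lemma sample_mean_chebyshev j (t : R) : (forall w, 0 <= g w <= 1) -> 0 < t ->
  1 - 1 / (2 ^+ j * t ^+ 2) <=
  coin_mean (2 ^ j * b) (fun w => (`|sample_mean j w - mu| <= t)%R%:R).
Proof.
move=> g01 t0; have t20 : 0 < t ^+ 2 by rewrite exprn_gt0.
have p0 : 0 < 2 ^+ j :> R by rewrite exprn_gt0.
have mu01 : 0 <= mu <= 1.
  apply/andP; split; first by apply: coin_mean_ge0 => w _; case/andP: (g01 w).
  by rewrite -(coin_mean_cst b 1); apply: le_coin_mean => w _; case/andP: (g01 w).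
have var1 : coin_mean b (fun w => (g w - mu) ^+ 2) <= 1.
  rewrite -(coin_mean_cst b 1); apply: le_coin_mean => w _.
  have /andP[g0 g1] := g01 w; case/andP: mu01 => m0 m1.
  by rewrite -subr_ge0 (_ : _ - _ = (1 - (g w - mu)) * (1 + (g w - mu)));
    [apply: mulr_ge0; lra | ring].
apply: (@le_trans _ _ (coin_mean (2 ^ j * b) (fun w =>
    1 - (t ^+ 2)^-1 * (sample_mean j w - mu) ^+ 2))).
  rewrite coin_meanB coin_mean_cst coin_meanZ sample_mean_variance lerD2l lerN2.
  rewrite mulrCA; set V := coin_mean b _ in var1 *.
  rewrite (_ : 1 / _ = 1 * (t ^- 2 / 2 ^+ j)); last first.
    by field; rewrite !expf_neq0 ?gt_eqF.
  by rewrite ler_wpM2r // divr_ge0 ?invr_ge0 // ltW.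
apply: le_coin_mean => w _; case: (lerP `|_| t) => [_|lt].
  by rewrite lerBlDr lerDl mulr_ge0 ?sqr_ge0 // invr_ge0 ltW.
rewrite lerBlDr add0r mulrC ler_pdivlMr // mul1r -[leRHS]real_normK ?num_real //.
by rewrite ler_pXn2r ?nnegrE ?ltW // (lt_trans t0).
Qed.

End Sampling.

(** * The program *)

Local Open Scope nat_scope.
Definition enc_dom (dom : seq (Q * Q)) : tree :=
  enc_seq (fun d => Node (enc_Q d.1) (enc_Q d.2)) dom.

Fixpoint quote (t : tree) : expr :=
  if t is Node l r then ENode (quote l) (quote r) else ELeaf.

Definition etag (n : nat) (e : expr) : expr := ENode (quote (enc_nat n)) e.
Definition eTVar e := etag 0 e.
Definition eTCst e := etag 1 e.
Definition eTAdd e1 e2 := etag 2 (ENode e1 e2).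
Definition eTScale e1 e2 := etag 3 (ENode e1 e2).
Definition eFLe e1 e2 := etag 0 (ENode e1 e2).
Definition eFEq e1 e2 := etag 2 (ENode e1 e2).
Definition eFAnd e1 e2 := etag 4 (ENode e1 e2).

Definition Qhalf : Q := QArith_base.Qmake (Zpos xH) (xO xH).
Definition Qtwo : Q := QArith_base.Qmake (Zpos (xO xH)) xH.
Definition Qone : Q := QArith_base.Qmake (Zpos xH) xH.
Definition Qzero : Q := QArith_base.Qmake Z0 xH.

(* Tuples are right-nested pairs.  The comment above a function describes its
   argument; those inside list the environment, most recent variable first. *)

(* (t, u): prepends to u one leaf for each node and leaf of t. *)
Definition p_flatten : expr :=
  ECase (EVar 0) ELeaf
    (ECase (EVar 0) (ENode ELeaf (EVar 1))
      (ENode ELeaf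
        (ECall 1 (ENode (EVar 0) (ECall 1 (ENode (EVar 1) (EVar 3))))))).

(* Counts the leading zeros of the numerator track. *)
Definition p_scan : expr :=
  ECase (EVar 0) ELeaf
    (ECase (EVar 0) ELeaf
      (ECase (EVar 0) (ENode ELeaf (ECall 2 (EVar 3))) ELeaf)).

(** The final leaf decodes as the leading 1 of a positive, so B coins form the numeral 2^B plus the
    number they spell, without any normalisation of leading zeros. *)
Definition p_bits : expr :=
  ECase (EVar 0) ELeaf (ENode EFlip (ECall 3 (EVar 1))).

(** Argument (t, u): only the right spine of t is followed, so the same code adds two unary numbers
    or adds the length of a list to a number. *)
Definition p_append : expr :=
  ECase (EVar 0) ELeaf
    (ECase (EVar 0) (EVar 1)
      (ENode ELeaf (ECall 4 (ENode (EVar 1) (EVar 3))))).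

(* (B, psi, i, dom) *)
Definition p_grid_form : expr :=
  ECase (EVar 0) ELeaf
  (ECase (EVar 1) ELeaf
  (ECase (EVar 1) ELeaf
  (ECase (EVar 1) (EVar 2)
  (ECase (EVar 0) ELeaf
  (ELet (ECall 3 (EVar 8))
  (ELet (eTCst (ENode (ENode ELeaf (EVar 0)) (EVar 9))) (* q p a b _ dom' i _ psi _ B *)
    (eFAnd
      (eFEq
        (eTAdd (eTVar (EVar 6)) (eTAdd (eTScale (EVar 2) (EVar 0)) (eTCst (EVar 3))))
        (eTAdd (eTScale (EVar 2) (eTCst (quote (enc_Q Qtwo)))) (eTScale (EVar 3) (EVar 0))))
      (ECall 5 (ENode (EVar 10) (ENode (EVar 8) (ENode (ENode ELeaf (EVar 6)) (EVar 5)))))))))))).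

(* (B, psi, dom, sorts, j) *)
Definition p_sample : expr :=
  ECase (EVar 0) ELeaf
  (ECase (EVar 1) ELeaf
  (ECase (EVar 1) ELeaf
  (ECase (EVar 1) ELeaf (* sorts j dom _ psi _ B _ *)
  (ECase (EVar 1)
    (ECase (EQuery (ENode (EVar 0)
        (ECall 5 (ENode (EVar 6) (ENode (EVar 4) (ENode ELeaf (EVar 2)))))))
      (quote (enc_term (TCst Qzero))) (quote (enc_term (TCst Qone))))
    (ELet (ENode (EVar 8) (ENode (EVar 6) (ENode (EVar 4) (ENode (EVar 2) (EVar 1)))))
      (eTScale (quote (enc_Q Qhalf)) (eTAdd (ECall 6 (EVar 0)) (ECall 6 (EVar 0))))))))).

(* (c, i, dom) *)
Definition p_volume_form : expr :=
  ECase (EVar 0) ELeaf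
  (ECase (EVar 1) ELeaf
  (ECase (EVar 1) (eFLe (EVar 2) (eTVar (EVar 0)))
  (ECase (EVar 0) ELeaf (* a b _ dom' i dom c _ *)
    (eFAnd
      (eFEq (eTAdd (eTVar (ENode ELeaf (EVar 4))) (eTScale (EVar 0) (eTVar (EVar 4))))
            (eTScale (EVar 1) (eTVar (EVar 4))))
      (ECall 7 (ENode (EVar 6) (ENode (ENode ELeaf (EVar 4)) (EVar 3)))))))).

(* (n, z, den, sorts, V0, dom) *)
Definition p_bisect : expr :=
  ECase (EVar 0) ELeaf
  (ECase (EVar 1) ELeaf
  (ECase (EVar 1) ELeaf
  (ECase (EVar 1) ELeaf
  (ECase (EVar 1) ELeaf (* V0 dom sorts _ den _ z _ n *)
  (ECase (EVar 8) (EVar 6)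
  (ELet (ENode ELeaf (EVar 6))
  (ELet (ECase (EVar 9) (quote (Node Leaf Leaf))
          (ENode (EVar 0) (ENode (quote (tree_of_bool true)) (EVar 1))))
    (* z' den' _ n' V0 dom sorts _ den _ z *)
  (ECase (EQuery (ENode (EVar 6) (eFAnd (EVar 4)
      (ECall 7 (ENode (eTCst (ENode (EVar 0) (EVar 1))) (ENode ELeaf (EVar 5)))))))
    (ECall 8 (ENode (EVar 3) (ENode
      (ECase (EVar 10) ELeaf (ENode (EVar 0) (ENode (quote (tree_of_bool false)) (EVar 1))))
      (ENode (EVar 1) (ENode (EVar 6) (ENode (EVar 4) (EVar 5)))))))
    (ECall 8 (ENode (EVar 5) (ENode (EVar 2)
      (ENode (EVar 3) (ENode (EVar 8) (ENode (EVar 6) (EVar 7))))))))))))))).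

(** Three flattenings of the code of phi on top of 6 + e give M in unary, and 8 + e + e gives the
    logarithm of the number of samples. The output pairs the numerator found by bisection with M
    itself, read as the denominator 2^M. *)
Definition p_main : expr :=
  ECase (EVar 0) ELeaf
  (ECase (EVar 0) ELeaf
  (ECase (EVar 1) ELeaf (* m psi dom _ phi gamma *)
  (ELet (ECall 2 (EVar 5)) (* e m psi dom _ phi gamma *)
  (ELet (ECall 1 (ENode (EVar 5) (ECall 1 (ENode (EVar 5) (ECall 1 (ENode (EVar 5)
          (iter 6 (ENode ELeaf) (EVar 0))))))))
  (ELet (ECall 4 (ENode (EVar 1) (iter 8 (ENode ELeaf) (EVar 1))))
    (* j B e m psi dom *)
  (ELet (ECall 6 (ENode (EVar 1) (ENode (EVar 4) (ENode (EVar 5)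
          (ENode (ECall 4 (ENode (EVar 5) (EVar 3))) (EVar 0))))))
    (* S j B e m psi dom *)
  (ELet (eFEq (eTVar ELeaf)
          (eTScale (ENode (quote (Node Leaf Leaf)) (EVar 2)) (EVar 0)))
    (* V0 S j B e m psi dom *)
  (ENode (ECall 8
      (ENode (ECall 4 (ENode (EVar 3) (EVar 3)))
      (ENode ELeaf (ENode ELeaf
      (ENode (ECall 4 (ENode (EVar 7) (quote (Node Leaf Leaf))))
      (ENode (EVar 0) (EVar 7)))))))
    (EVar 3))))))))).

Definition counting_program : Defs.program :=
  [:: p_main; p_flatten; p_scan; p_bits; p_append; p_grid_form; p_sample;
      p_volume_form; p_bisect].

Fixpoint bits_pos (w : seq bool) : positive :=
  if w is b :: w' then (if b then xI else xO) (bits_pos w') else xH.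

Definition pow2_pos (n : nat) : positive := iter n xO xH.

(** A zero bit and a unary stroke are both [Node Leaf], so a unary exponent is already the numeral
    of its power of two. *)
Lemma enc_pow2_pos n : enc_pos (pow2_pos n) = enc_nat n.
Proof. by elim: n => //= n ->. Qed.

Lemma enc_Q_pow2 z n :
  enc_Q (QArith_base.Qmake z (pow2_pos n)) = Node (enc_Z z) (enc_nat n).
Proof. by rewrite /enc_Q enc_pow2_pos. Qed.

(* The numeral q stands for 1 + t with t the dyadic number given by the coins, so
   that the equation x + (a q + b) = 2 a + b q means x = a + (b - a) t. *)
Fixpoint grid_form (B i : nat) (dom : seq (Q * Q)) (w : seq bool)
    (psi : Defs.form) : Defs.form :=
  if dom is (a, b) :: dom' then
    let q := TCst (QArith_base.Qmake (Zpos (bits_pos (take B w))) (pow2_pos B)) in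
    FAnd (FEq (TAdd (TVar i) (TAdd (TScale a q) (TCst b)))
              (TAdd (TScale a (TCst Qtwo)) (TScale b q)))
         (grid_form B i.+1 dom' (drop B w) psi)
  else psi.

(** The bounds a and b are constants, so multiplying the running product by b - a is linear; a moves
    to the left-hand side because terms have no subtraction. *)
Fixpoint volume_form (c : term) (i : nat) (dom : seq (Q * Q)) : Defs.form :=
  if dom is (a, b) :: dom' then
    FAnd (FEq (TAdd (TVar i.+1) (TScale a (TVar i))) (TScale b (TVar i)))
         (volume_form c i.+1 dom')
  else FLe c (TVar i).

Definition Zshift (b : bool) (z : Z) : Z :=
  match z with
  | Z0 => if b then Zpos xH else Z0
  | Zpos p => Zpos ((if b then xI else xO) p)
  | Zneg p => Zneg ((if b then xI else xO) p)
  end.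

(** * Symbolic execution with upper bounds on time *)

Section Run.
Variable O : tree -> bool.

Definition runs env w e v w' n :=
  exists2 c, evalsto counting_program O env w e v w' c & (c <= n)%N.

Definition calls f v w v' w' n :=
  exists2 body, onth counting_program f = Some body & runs [:: v] w body v' w' n.

Lemma runs_le n env w e v w' n' :
  runs env w e v w' n -> (n <= n')%N -> runs env w e v w' n'.
Proof. by move=> [c ec cn] nn'; exists c => //; exact: leq_trans nn'. Qed.

Lemma runs_var env w i v : nth Leaf env i = v -> runs env w (EVar i) v w 1.
Proof. by move=> <-; exists 1%N => //; constructor. Qed.

Lemma runs_leaf env w : runs env w ELeaf Leaf w 1.
Proof. by exists 1%N => //; constructor. Qed.

Lemma runs_node env w e1 e2 v1 v2 w1 w2 n1 n2 :
  runs env w e1 v1 w1 n1 -> runs env w1 e2 v2 w2 n2 ->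
  runs env w (ENode e1 e2) (Node v1 v2) w2 (n1 + n2).+1.
Proof.
move=> [c1 E1 l1] [c2 E2 l2]; exists (c1 + c2).+1; last by rewrite ltnS leq_add.
exact: eval_node E1 E2.
Qed.

Lemma runs_case_leaf env w e e0 e1 v w1 w2 n1 n2 :
  runs env w e Leaf w1 n1 -> runs env w1 e0 v w2 n2 ->
  runs env w (ECase e e0 e1) v w2 (n1 + n2).+1.
Proof.
move=> [c1 E1 l1] [c2 E2 l2]; exists (c1 + c2).+1; last by rewrite ltnS leq_add.
exact: eval_case_leaf E1 E2.
Qed.

Lemma runs_case_node env w e e0 e1 l r v w1 w2 n1 n2 :
  runs env w e (Node l r) w1 n1 -> runs [:: l, r & env] w1 e1 v w2 n2 ->
  runs env w (ECase e e0 e1) v w2 (n1 + n2).+1.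
Proof.
move=> [c1 E1 l1] [c2 E2 l2]; exists (c1 + c2).+1; last by rewrite ltnS leq_add.
exact: eval_case_node E1 E2.
Qed.

Lemma runs_let env w e1 e2 v1 v2 w1 w2 n1 n2 :
  runs env w e1 v1 w1 n1 -> runs (v1 :: env) w1 e2 v2 w2 n2 ->
  runs env w (ELet e1 e2) v2 w2 (n1 + n2).+1.
Proof.
move=> [c1 E1 l1] [c2 E2 l2]; exists (c1 + c2).+1; last by rewrite ltnS leq_add.
exact: eval_let E1 E2.
Qed.

Lemma runs_call env w f e v1 v2 w1 w2 n1 n2 :
  runs env w e v1 w1 n1 -> calls f v1 w1 v2 w2 n2 ->
  runs env w (ECall f e) v2 w2 (n1 + n2).+1.
Proof.
move=> [c1 E1 l1] [body fE [c2 E2 l2]]; exists (c1 + c2).+1; last by rewrite ltnS leq_add.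
exact: eval_call fE E1 E2.
Qed.

Lemma runs_flip env w b : runs env (b :: w) EFlip (tree_of_bool b) w 1.
Proof. by exists 1%N => //; constructor. Qed.

Lemma runs_case_query env w e e0 e1 u v w1 w2 n1 n2 :
  runs env w e u w1 n1 ->
  (if O u then runs [:: Leaf, Leaf & env] w1 e1 v w2 n2
   else runs env w1 e0 v w2 n2) ->
  runs env w (ECase (EQuery e) e0 e1) v w2 (n1 + Defs.tsize u + n2).+2.
Proof.
move=> [c1 E1 l1] H.
have E : evalsto counting_program O env w (EQuery e) (tree_of_bool (O u)) w1
    (c1 + Defs.tsize u).+1 by exact: eval_query E1.
case: (O u) E H => /= E [c2 E2 l2]; exists ((c1 + Defs.tsize u).+1 + c2).+1; try lia.
  exact: eval_case_node E E2.
exact: eval_case_leaf E E2.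
Qed.

Lemma runs_quote env w t : runs env w (quote t) t w (Defs.tsize t).
Proof. by elim: t w => [|l IHl r IHr] w /=; [exact: runs_leaf|exact: runs_node]. Qed.

Lemma calls_intro f body v w v' w' n n' : onth counting_program f = Some body ->
  runs [:: v] w body v' w' n -> (n <= n')%N -> calls f v w v' w' n'.
Proof. by move=> fE r le; exists body => //; exact: runs_le le. Qed.

End Run.

(** The cost is an existential variable filled in by the rules; subroutine calls and branchings on
    unknown values are left as goals. *)
Ltac run :=
  match goal with
  | |- runs _ _ _ (EVar _) _ _ _ => eapply runs_var; cbn [nth]; reflexivity
  | |- runs _ _ _ ELeaf _ _ _ => apply runs_leaf
  | |- runs _ _ _ (quote _) _ _ _ => apply runs_quote
  | |- runs _ _ _ (iter _ _ _) _ _ _ => simpl iter; run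
  | |- runs _ _ _ EFlip _ _ _ => apply runs_flip
  | |- runs _ _ _ (ENode _ _) _ _ _ => eapply runs_node; [run | run]
  | |- runs _ _ _ (ELet _ _) _ _ _ => eapply runs_let; [run | run]
  | |- runs _ _ _ (ECall _ _) _ _ _ => eapply runs_call; [run | idtac]
  | |- runs _ _ _ (ECase (EQuery _) _ _) _ _ _ => eapply runs_case_query; [run | idtac]
  | |- runs _ _ _ (ECase _ _ _) _ _ _ =>
    first [ eapply runs_case_node; [eapply runs_var; cbn [nth]; reflexivity | run]
          | eapply runs_case_leaf; [eapply runs_var; cbn [nth]; reflexivity | run]
          | idtac ]
  | |- _ => idtac
  end.

Ltac run_body body :=
  eapply calls_intro;
  [reflexivity
  |cbv delta [body eTVar eTCst eTAdd eTScale eFLe eFEq eFAnd etag] beta; run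
  |].

Section Subroutines.
Variable O : tree -> bool.

Fixpoint spine (t : tree) : nat := if t is Node _ r then (spine r).+1 else 0.

Lemma spine_enc_nat n : spine (enc_nat n) = n.
Proof. by elim: n => //= n ->. Qed.

Lemma spine_enc_seq T (f : T -> tree) s : spine (enc_seq f s) = size s.
Proof. by elim: s => //= x s ->. Qed.

Lemma calls_append t u w :
  calls O 4 (Node t u) w (iter (spine t) (Node Leaf) u) w (20 * (spine t).+1).
Proof.
elim: t u w => [|l _ r IHr] u w; first by run_body p_append.
run_body p_append; first exact: IHr.
by move=> /=; lia.
Qed.

Lemma calls_flatten t u w :
  calls O 1 (Node t u) w (iter (Defs.tsize t) (Node Leaf) u) w (20 * Defs.tsize t).
Proof.
elim: t u w => [|l IHl r IHr] u w; first by run_body p_flatten.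
rewrite /= iterD.
run_body p_flatten; [exact: IHr|exact: IHl|lia].
Qed.

(** Reading stops at the first 1, so the time depends on the magnitude of the tolerance and not on
    the length of its numerals. *)
Lemma calls_scan (s : seq (bool * bool)) w :
  calls O 2 (enc_seq (fun b => Node (tree_of_bool b.1) (tree_of_bool b.2)) s) w
    (enc_nat (find fst s)) w (20 * (find fst s).+1).
Proof.
elim: s w => [|[[] b] s IHs] w /=; try by run_body p_scan.
by run_body p_scan; [exact: IHs|lia].
Qed.

Lemma calls_bits B w : B <= size w ->
  calls O 3 (enc_nat B) w (enc_pos (bits_pos (take B w))) (drop B w) (20 * B.+1).
Proof.
elim: B w => [|B IHB] w.
  by rewrite take0 drop0 => _; run_body p_bits.
case: w => //= b w Bw.
have -> : enc_pos ((if b then xI else xO) (bits_pos (take B w))) =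
    Node (tree_of_bool b) (enc_pos (bits_pos (take B w))) by case: b.
by run_body p_bits; [exact: IHB|lia].
Qed.

Lemma calls_grid_form B i dom w psi : size dom * B <= size w ->
  calls O 5 (Node (enc_nat B) (Node (enc_form psi) (Node (enc_nat i) (enc_dom dom))))
    w (enc_form (grid_form B i dom w psi)) (drop (size dom * B) w)
    (size dom * (20 * B + 400) + 20).
Proof.
elim: dom i w => [|[a b] dom IHd] i w /=.
  by rewrite drop0 => _; run_body p_grid_form.
rewrite mulSn => sw.
rewrite !enc_Q_pow2 [B + _]addnC -drop_drop.
run_body p_grid_form; [apply: calls_bits; lia|apply: (IHd i.+1)|].
  by rewrite size_drop; lia.
by move=> /=; lia.
Qed.

Definition grid_query (B : nat) (dom : seq (Q * Q)) (nv : nat) (psi : Defs.form)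
    (w : seq bool) : mixed :=
  Mixed (nseq nv SReal) (grid_form B 0 dom w psi).

(** The mean stays an unevaluated term with one constant per sample; the oracle evaluates it later,
    inside the queries of the bisection. *)
Fixpoint sample_term (B : nat) (dom : seq (Q * Q)) (nv : nat) (psi : Defs.form)
    (j : nat) (w : seq bool) : term :=
  if j is j'.+1 then
    TScale Qhalf (TAdd (sample_term B dom nv psi j' w)
      (sample_term B dom nv psi j' (drop (2 ^ j' * (size dom * B)) w)))
  else TCst (if O (enc_mixed (grid_query B dom nv psi w)) then Qone else Qzero).

Lemma tsize_enc_nat n : Defs.tsize (enc_nat n) = (2 * n).+1.
Proof. by elim: n => //= n ->; lia. Qed.

Lemma enc_sorts n : enc_seq enc_sort (nseq n SReal) = enc_nat n.
Proof. by elim: n => //= n ->. Qed.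

Lemma tsize_bits_pos w : Defs.tsize (enc_pos (bits_pos w)) <= 4 * size w + 1.
Proof. by elim: w => //= -[] w /=; lia. Qed.

Lemma tsize_grid_form B i dom w psi :
  Defs.tsize (enc_form (grid_form B i dom w psi)) <=
  size dom * (2 * (i + size dom) + 20 * B + 200) + 2 * Defs.tsize (enc_dom dom) +
    Defs.tsize (enc_form psi).
Proof.
elim: dom i w => [|[a b] dom IHd] i w /=; first by lia.
have := IHd i.+1 (drop B w); have := tsize_bits_pos (take B w).
have : size (take B w) <= B by rewrite size_take_min geq_minl.
rewrite enc_pow2_pos !tsize_enc_nat /=.
move: (Defs.tsize (enc_form _)) => X.
move: (Defs.tsize (enc_pos (bits_pos _))) => Y sY leY leX.
by move: sY leY leX; rewrite -/(enc_dom dom) mulSn addSnnS; lia.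
Qed.

(** [X] pays for building and asking one query. The subtracted 100 closes the doubling recursion:
    two calls save 200, of which 100 cover the work at the joining node. *)
Lemma calls_sample B dom nv psi j w X : 2 ^ j * (size dom * B) <= size w ->
    size dom * (20 * B + 400) + 20 +
    (2 * nv + size dom * (2 * size dom + 20 * B + 200) +
      2 * Defs.tsize (enc_dom dom) + Defs.tsize (enc_form psi)) <= X ->
  calls O 6 (Node (enc_nat B) (Node (enc_form psi) (Node (enc_dom dom)
      (Node (enc_nat nv) (enc_nat j))))) w
    (enc_term (sample_term B dom nv psi j w)) (drop (2 ^ j * (size dom * B)) w)
    (2 ^ j * (X + 200) - 100).
Proof.
move=> + leX; elim: j w => [|j IHj] w sw.
  rewrite mul1n in sw *.
  have qE : enc_mixed (grid_query B dom nv psi w) =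
      Node (enc_nat nv) (enc_form (grid_form B 0 dom w psi)).
    by rewrite /enc_mixed /= enc_sorts.
  rewrite [sample_term _ _ _ _ _ _]/= qE.
  run_body p_sample; first exact: (@calls_grid_form B 0).
    by case: (O _); eapply (@runs_le O) with (n' := 20);
      [apply runs_quote | | apply runs_quote | ].
  rewrite /= tsize_enc_nat.
  have := tsize_grid_form B 0 dom w psi; rewrite add0n.
  by lia.
move: sw; rewrite expnS -mulnA mul2n -addnn => sw.
rewrite -drop_drop.
run_body p_sample.
- by apply: IHj; lia.
- by apply: IHj; rewrite size_drop; lia.
(* Ensures that the truncated subtraction of 100 is genuine in both recursive calls. *)
have : 200 <= 2 ^ j * (X + 200) by rewrite -[200]mul1n leq_mul ?expn_gt0 ?leq_addl.
by rewrite -mulnA /=; lia.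
Qed.

Lemma calls_volume_form c i dom w :
  calls O 7 (Node (enc_term c) (Node (enc_nat i) (enc_dom dom))) w
    (enc_form (volume_form c i dom)) w (200 * (size dom).+1).
Proof.
elim: dom i => [|[a b] dom IHd] i; first by run_body p_volume_form.
run_body p_volume_form; first exact: (IHd i.+1).
by move=> /=; lia.
Qed.

Lemma tsize_volume_form c i dom :
  Defs.tsize (enc_form (volume_form c i dom)) <=
  size dom * (8 * (i + size dom) + 200) + 2 * (i + size dom) +
    2 * Defs.tsize (enc_dom dom) + Defs.tsize (enc_term c) + 10.
Proof.
elim: dom i => [|[a b] dom IHd] i /=; first by rewrite tsize_enc_nat; lia.
have := IHd i.+1; rewrite !tsize_enc_nat /= -/(enc_dom dom).
by lia.
Qed.

Definition bisect_query (V0 : Defs.form) (dom : seq (Q * Q)) (z : Z) (t : nat) :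
    mixed :=
  Mixed (nseq (size dom).+1 SReal)
    (FAnd V0 (volume_form (TCst (QArith_base.Qmake z (pow2_pos t))) 0 dom)).

Fixpoint bisect (V0 : Defs.form) (dom : seq (Q * Q)) (n : nat) (z : Z) (t : nat) : Z :=
  if n is n'.+1 then
    if O (enc_mixed (bisect_query V0 dom (Zshift true z) t.+1)) then
      bisect V0 dom n' (Zshift true z) t.+1
    else bisect V0 dom n' (Zshift false z) t.+1
  else z.

Lemma tsize_Zshift b z : Defs.tsize (enc_Z (Zshift b z)) <= Defs.tsize (enc_Z z) + 4.
Proof. by case: z b => [|p|p] [] /=; lia. Qed.

Lemma runs_Zshift b z env i w : nth Leaf env i = enc_Z z ->
  runs O env w
    (ECase (EVar i) (if b then quote (Node Leaf Leaf) else ELeaf)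
      (ENode (EVar 0) (ENode (quote (tree_of_bool b)) (EVar 1))))
    (enc_Z (Zshift b z)) w 10.
Proof.
move=> zE; have iE := runs_var O w zE.
have [c ec le] : exists2 c, runs O env w
    (ECase (EVar i) (if b then quote (Node Leaf Leaf) else ELeaf)
      (ENode (EVar 0) (ENode (quote (tree_of_bool b)) (EVar 1))))
    (enc_Z (Zshift b z)) w c & c <= 10; last exact: runs_le ec le.
case: z b zE iE => [|p|p] [] /= zE iE; eexists;
  try (eapply runs_case_leaf; [exact: iE|by run]);
  try (eapply runs_case_node; [exact: iE|by run]); by [].
Qed.

(** [X] bounds one round. It is expressed through the size of [z] plus [4 * n] and through [t + n],
    which do not increase from one round to the next. *)
Lemma calls_bisect V0 dom n z t w X :
    500 + 300 * (size dom).+1 + (Defs.tsize (enc_Z z) + 4 * n) + 2 * (t + n) +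
    Defs.tsize (enc_form V0) + size dom * (8 * size dom + 200) +
    2 * Defs.tsize (enc_dom dom) <= X ->
  calls O 8 (Node (enc_nat n) (Node (enc_Z z) (Node (enc_nat t)
      (Node (enc_nat (size dom).+1) (Node (enc_form V0) (enc_dom dom)))))) w
    (enc_Z (bisect V0 dom n z t)) w (n * X + 100).
Proof.
elim: n z t => [|n IHn] z t leX; first by run_body p_bisect; lia.
have leX1 b : 500 + 300 * (size dom).+1 + (Defs.tsize (enc_Z (Zshift b z)) + 4 * n) +
    2 * (t.+1 + n) + Defs.tsize (enc_form V0) + size dom * (8 * size dom + 200) +
    2 * Defs.tsize (enc_dom dom) <= X.
  by have := tsize_Zshift b z; lia.
have qE : enc_mixed (bisect_query V0 dom (Zshift true z) t.+1) =
    Node (enc_nat (size dom).+1)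
      (enc_form (FAnd V0 (volume_form
         (TCst (QArith_base.Qmake (Zshift true z) (pow2_pos t.+1))) 0 dom))).
  by rewrite /enc_mixed /mixed_sorts enc_sorts.
rewrite [bisect _ _ _ _ _]/= qE.
set c := TCst (QArith_base.Qmake (Zshift true z) (pow2_pos t.+1)).
have cE : enc_term c = Node (enc_nat 1) (Node (enc_Z (Zshift true z)) (enc_nat t.+1)).
  by rewrite -enc_Q_pow2.
have callv := calls_volume_form c 0 dom w; rewrite cE in callv.
run_body p_bisect.
- exact: (runs_Zshift true).
- exact: callv.
- case: (O _); eapply (runs_le (n' := n * X + 200)).
  + by run; exact: (IHn _ _ (leX1 true)).
  + by move=> /=; lia.
  + by run; [exact: (runs_Zshift false)|exact: (IHn _ _ (leX1 false))].
  + by move=> /=; lia.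
have := tsize_volume_form c 0 dom; rewrite cE /= !tsize_enc_nat /=.
have := tsize_Zshift true z.
by rewrite !add0n /=; lia.
Qed.

End Subroutines.

(** * Time and output of the whole program *)

Section MainProgram.
Variable O : tree -> bool.

Lemma iter_enc_nat m n : iter m (Node Leaf) (enc_nat n) = enc_nat (m + n).
Proof. by rewrite /enc_nat iterD. Qed.

Lemma tsize_sample_term B dom nv psi j w :
  Defs.tsize (enc_term (sample_term O B dom nv psi j w)) + 30 <= 2 ^ j * 50.
Proof.
elim: j w => [|j IHj] w; first by rewrite /=; case: (O _).
have := IHj w; have := IHj (drop (2 ^ j * (size dom * B)) w).
rewrite expnS /=; lia.
Qed.

Lemma tsize_bisect V0 dom n z t :
  Defs.tsize (enc_Z (bisect O V0 dom n z t)) <= Defs.tsize (enc_Z z) + 4 * n.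
Proof.
elim: n z t => [|n IHn] z t /=; first by lia.
by case: (O _); [have := IHn (Zshift true z) t.+1|have := IHn (Zshift false z) t.+1];
  [have := tsize_Zshift true z|have := tsize_Zshift false z]; lia.
Qed.

(* Number of bits used for the coordinates, for the magnitude of the volume and
   for rounding: 2^|phi| bounds k, the volume and its inverse if nonzero, and
   4^|phi| bounds 3^L. *)
Definition precision (phi : lra) (e : nat) : nat := 3 * lra_size phi + (6 + e).

(** The factor 2^-M brings the number to be found below 1, so that bisection can start from the
    interval [0, 1). *)
Definition volume_eq (phi : lra) (e : nat) (w : seq bool) : Defs.form :=
  let M := precision phi e in
  FEq (TVar 0) (TScale (QArith_base.Qmake (Zpos xH) (pow2_pos M))
    (sample_term O M (lra_dom phi) (lra_arity phi + lra_nex phi)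
       (lra_matrix phi) (8 + 2 * e) w)).

(** Of the 2M binary digits found, M make up for the scaling in [volume_eq] and M remain after the
    point; writing 2^M instead of 2^(2M) below undoes the scaling. *)
Definition estimate (phi : lra) (e : nat) (w : seq bool) : Q :=
  let M := precision phi e in
  QArith_base.Qmake (bisect O (volume_eq phi e w) (lra_dom phi) (M + M) Z0 0) (pow2_pos M).

Definition run_time (phi : lra) (e : nat) : nat :=
  2000 * (2 ^ (8 + 2 * e) * precision phi e ^ 3).

Definition coins (phi : lra) (e : nat) : nat :=
  2 ^ (8 + 2 * e) * (lra_arity phi * precision phi e).

Lemma size_le_tsize_enc_seq T (f : T -> tree) (s : seq T) :
  size s < Defs.tsize (enc_seq f s).
Proof. by elim: s => //= x s; lia. Qed.

Lemma lra_size_ge phi :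
  Defs.tsize (enc_dom (lra_dom phi)) + 2 * lra_nex phi +
    Defs.tsize (enc_form (lra_matrix phi)) < lra_size phi.
Proof. by rewrite /lra_size /enc_lra /= tsize_enc_nat -/(enc_dom _); lia. Qed.

Lemma arity_le_size phi : lra_arity phi + lra_nex phi < lra_size phi.
Proof.
have := lra_size_ge phi.
by have := size_le_tsize_enc_seq (fun d => Node (enc_Q d.1) (enc_Q d.2)) (lra_dom phi);
  rewrite -/(enc_dom _) -/(lra_arity phi); lia.
Qed.

Lemma coins_le_run_time phi e : coins phi e <= run_time phi e.
Proof.
rewrite /coins /run_time [leqRHS]mulnCA leq_mul2l; apply/orP; right.
have : lra_arity phi <= precision phi e.
  by have := arity_le_size phi; rewrite /precision; lia.
set M := precision _ _ => kM.
have M0 : 0 < M by rewrite /M /precision; lia.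
rewrite !expnS expn0 muln1; apply: (@leq_trans (M * M)); first by rewrite leq_mul2r kM orbT.
by nia.
Qed.

(** The amount subtracted from [run_time] leaves room for the entry call, which costs 2, and for the
    charge on the output. *)
Lemma calls_main phi (s : seq (bool * bool)) w (e := find fst s) :
  coins phi e <= size w ->
  calls O 0 (Node (enc_lra phi)
      (enc_seq (fun b => Node (tree_of_bool b.1) (tree_of_bool b.2)) s)) w
    (enc_Q (estimate phi e w)) (drop (coins phi e) w)
    (run_time phi e - 2 - Defs.tsize (enc_Q (estimate phi e w))).
Proof.
move=> sw.
set M := precision phi e.
rewrite /estimate enc_Q_pow2 -/M.
have ME : iter (lra_size phi) (Node Leaf) (iter (lra_size phi) (Node Leaf)
   (iter (lra_size phi) (Node Leaf) (iter 6 (Node Leaf) (enc_nat e)))) = enc_nat M.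
  by rewrite !iter_enc_nat; congr enc_nat; rewrite /M /precision; lia.
have jE : iter (spine (enc_nat e)) (Node Leaf) (iter 8 (Node Leaf) (enc_nat e)) =
    enc_nat (8 + 2 * e).
  by rewrite spine_enc_nat !iter_enc_nat; congr enc_nat; lia.
have vE : iter (spine (enc_dom (lra_dom phi))) (Node Leaf) (enc_nat (lra_nex phi)) =
    enc_nat (lra_arity phi + lra_nex phi).
  by rewrite spine_enc_seq iter_enc_nat.
have nE : iter (spine (enc_nat M)) (Node Leaf) (enc_nat M) = enc_nat (M + M).
  by rewrite spine_enc_nat iter_enc_nat.
have kE : iter (spine (enc_dom (lra_dom phi))) (Node Leaf) (enc_nat 1) =
    enc_nat (lra_arity phi).+1.
  by rewrite spine_enc_seq iter_enc_nat addn1.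
have c3 : calls O 1 (Node (enc_lra phi) (iter 6 (Node Leaf) (enc_nat e))) w _ w _ :=
  calls_flatten O _ _ _.
have c2 : calls O 1 (Node (enc_lra phi) (iter (lra_size phi) (Node Leaf)
    (iter 6 (Node Leaf) (enc_nat e)))) w _ w _ := calls_flatten O _ _ _.
have c1 := calls_flatten O (enc_lra phi) (iter (lra_size phi) (Node Leaf)
   (iter (lra_size phi) (Node Leaf) (iter 6 (Node Leaf) (enc_nat e)))) w.
rewrite -/(lra_size phi) ME in c1.
have c4 := calls_append O (enc_nat e) (iter 8 (Node Leaf) (enc_nat e)) w.
rewrite jE in c4.
have c5 := calls_append O (enc_dom (lra_dom phi)) (enc_nat (lra_nex phi)) w.
rewrite vE in c5.
set w' := drop (coins phi e) w.
have c6 := calls_append O (enc_nat M) (enc_nat M) w'.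
rewrite nE in c6.
have c7 := calls_append O (enc_dom (lra_dom phi)) (enc_nat 1) w'.
rewrite kE in c7.
have c8 := @calls_sample O M (lra_dom phi) (lra_arity phi + lra_nex phi)
  (lra_matrix phi) (8 + 2 * e) w _ sw (leqnn _).
set S := sample_term _ _ _ _ _ _ _ in c8.
have VE : enc_form (volume_eq phi e w) = Node (enc_nat 2) (Node (Node (enc_nat 0) Leaf)
    (Node (enc_nat 3) (Node (Node (enc_Z (Zpos xH)) (enc_nat M)) (enc_term S)))).
  by rewrite -enc_Q_pow2.
have leS : Defs.tsize (enc_term S) + 30 <= 2 ^ (8 + 2 * e) * 50.
  exact: tsize_sample_term.
clearbody S.
have c9 := @calls_bisect O (volume_eq phi e w) (lra_dom phi) (M + M) Z0 0 w' _ (leqnn _).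
rewrite [X in Node X (enc_dom _)]VE in c9.
run_body p_main; [exact: calls_scan|exact: c3|exact: c2|exact: c1|exact: c4|
  exact: c5|exact: c8|exact: c6|exact: c7|exact: c9|].
move=> {c1 c2 c3 c4 c5 c6 c7 c8 c9}.
have leZ := tsize_bisect (volume_eq phi e w) (lra_dom phi) (M + M) Z0 0.
have leM : 3 * lra_size phi + (6 + e) = M by [].
have J256 : 256 <= 2 ^ (8 + 2 * e) by rewrite -[256]/(2 ^ 8) leq_pexp2l // leq_addr.
have szE : Defs.tsize (enc_lra phi) = lra_size phi by [].
have szD := lra_size_ge phi; have szk := arity_le_size phi.
rewrite /run_time -/M -/(lra_arity phi) szE in leS leZ *.
clearbody M.
rewrite VE !spine_enc_nat spine_enc_seq -/(lra_arity phi) -/e.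
move: leS leZ leM J256 szD szk.
move: (2 ^ (8 + 2 * e)) (lra_size phi) (lra_arity phi) (lra_nex phi)
  (Defs.tsize (enc_dom _)) (Defs.tsize (enc_form (lra_matrix _))).
rewrite /= !tsize_enc_nat.
move: (Defs.tsize (enc_term _)) (Defs.tsize (enc_Z _)).
(* From here on a numerical inequality: [T] is the size of the sample term, [Z] that of the
   numerator, [J] the number of samples, [D] and [P] the sizes of the domains and of the matrix. As
   [J >= 256] and [M >= 9], the monomial J M^3 absorbs all others. *)
move=> T Z J s' k m D P leT leZ leM J256 szD szk.
have kM : k <= M by lia.
have M9 : 9 <= M by lia.
have H1 : k * (20 * M + 400) <= M * (20 * M + 400) by rewrite leq_mul2r kM orbT.
have H2 : k * (2 * k + 20 * M + 200) <= M * (22 * M + 200) by apply: leq_mul; lia.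
have H3 : k * (8 * k + 200) <= M * (8 * M + 200) by apply: leq_mul; lia.
have MM : 9 * M <= M * M by rewrite leq_mul2r M9 orbT.
have H4 : J * (k * (20 * M + 400) + 20 +
     (2 * (k + m) + k * (2 * k + 20 * M + 200) + 2 * D + P) + 200) <= J * (1000 * (M * M)).
  by rewrite leq_mul2l; apply/orP; right; lia.
have MMM : 9 * (M * M) <= M * (M * M) by rewrite leq_mul2r M9 orbT.
have JM : 256 * M <= J * M by rewrite leq_mul2r J256 orbT.
have JMM : 9 * (J * M) <= J * (M * M) by rewrite mulnCA leq_mul2l MM orbT.
have JMMM : 9 * (J * (M * M)) <= J * (M * (M * M)) by rewrite mulnCA leq_mul2l MMM orbT.
have JMMM' : 256 * (M * (M * M)) <= J * (M * (M * M)) by rewrite leq_mul2r J256 orbT.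
have -> : M ^ 3 = M * (M * M) by rewrite !expnS expn0 muln1.
(* Each round of bisection writes out the whole sample term, of order J, and the volume equations,
   of order M^2. *)
set X := (X in (M + M) * X).
have H5 : (M + M) * X <= (M + M) * (60 * J + 300 * (M * M)).
  by rewrite leq_mul2l; apply/orP; right; rewrite /X; lia.
move: H5; rewrite /X mulnDl mulnDr !mulnA; lia.
Qed.
End MainProgram.

Local Open Scope ring_scope.

(** * Meaning of the queries *)

Section Numerals.
Variable R : realType.

Lemma to_nat_xI p : PosDef.Pos.to_nat (xI p) = (PosDef.Pos.to_nat p).*2.+1.
Proof. by lia. Qed.
Lemma to_nat_xO p : PosDef.Pos.to_nat (xO p) = (PosDef.Pos.to_nat p).*2.
Proof. by lia. Qed.

Lemma to_nat_pow2_pos n : PosDef.Pos.to_nat (pow2_pos n) = (2 ^ n)%N.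
Proof. by elim: n => //= n IHn; rewrite to_nat_xO IHn expnS mul2n. Qed.

Lemma to_nat_bits_pos w : PosDef.Pos.to_nat (bits_pos w) = (2 ^ size w + nat_of_bits w)%N.
Proof.
elim: w => //= b w IHw; rewrite expnS mul2n.
by case: b; rewrite ?to_nat_xI ?to_nat_xO IHw; lia.
Qed.

Lemma Qval_pow2 z n : Qval R (QArith_base.Qmake z (pow2_pos n)) =
  (int_of_Z z)%:~R / 2 ^+ n.
Proof. by rewrite /Qval /= to_nat_pow2_pos -pmulrn natrX. Qed.

Lemma int_of_Z_Zshift b z n : int_of_Z z = Posz n ->
  int_of_Z (Zshift b z) = Posz (b + n.*2).
Proof.
case: z => [|p|p] //= [<-]; first by case: b.
by case: b; rewrite ?to_nat_xI ?to_nat_xO.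
Qed.

Lemma Qval_Qhalf : Qval R Qhalf = 1 / 2.
Proof. by []. Qed.
Lemma Qval_Qtwo : Qval R Qtwo = 2.
Proof. by rewrite /Qval /= divr1. Qed.
Lemma Qval_Qone : Qval R Qone = 1.
Proof. by rewrite /Qval /= divr1. Qed.
Lemma Qval_Qzero : Qval R Qzero = 0.
Proof. by rewrite /Qval /= mul0r. Qed.
End Numerals.

Section Queries.
Variables (R : realType) (O : tree -> bool).
Hypothesis satO : is_sat_oracle R O.

Lemma mixed_sat_real n f : mixed_sat R (Mixed (nseq n SReal) f) <->
  exists2 x : seq R, size x = n & feval (nth 0 x) f.
Proof.
split=> [[x _ fx]|[x sx fx]].
  by exists x => //; rewrite size_tuple /= size_nseq.
have sx' : size x == size (mixed_sorts (Mixed (nseq n SReal) f)).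
  by rewrite /= size_nseq sx.
exists (Tuple sx') => // i.
by rewrite (tnth_nth SReal) /= nth_nseq if_same.
Qed.

Lemma form_vars_lt_grid_form n B i dom w psi : (i + size dom <= n)%N ->
  form_vars_lt n psi -> form_vars_lt n (grid_form B i dom w psi).
Proof.
elim: dom i w => [|[a b] dom IHd] i w //=; rewrite addnS => ile psin.
by rewrite IHd // ?addSn // !andbT; apply: leq_trans ile; rewrite ltnS leq_addr.
Qed.

Lemma form_vars_lt_volume_form n q i dom : (i + size dom < n)%N ->
  form_vars_lt n (volume_form (TCst q) i dom).
Proof.
elim: dom i => [|[a b] dom IHd] i /=; first by rewrite addn0.
rewrite addnS => ile; rewrite IHd ?addSn //; lia.
Qed.

Lemma feval_grid_form (v : nat -> R) B i dom w psi : (size dom * B <= size w)%N ->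
  feval v (grid_form B i dom w psi) <->
  (forall l, (l < size dom)%N -> v (i + l)%N =
    nth 0 (grid_tuple B [seq (Qval R d.1, Qval R d.2) | d <- dom] w) l) /\
  feval v psi.
Proof.
elim: dom i w => [|[a b] dom IHd] i w; first by move=> _ /=; split=> // -[].
move=> sw; have sB : size (take B w) = B.
  by rewrite size_takel // (leq_trans _ sw) //= mulSn leq_addr.
have sd : (size dom * B <= size (drop B w))%N.
  by move: sw; rewrite size_drop /= mulSn; lia.
pose q := QArith_base.Qmake (Zpos (bits_pos (take B w))) (pow2_pos B).
have eqE : (v i + (Qval R a * Qval R q + Qval R b) ==
    Qval R a * Qval R Qtwo + Qval R b * Qval R q) = (v i == grid_point (Qval R a) (Qval R b) B (take B w)).
  rewrite Qval_pow2 /= to_nat_bits_pos sB Qval_Qtwo -pmulrn natrD natrX.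
  rewrite mulrDl divff ?expf_neq0 // /grid_point.
  set x := _ / 2 ^+ B; apply/eqP/eqP => H; first by rewrite /x in H *; lra.
  rewrite H /x; ring.
have IH := IHd i.+1 _ sd.
split.
  move=> /= /andP[]; rewrite eqE => /eqP vi /IH [vl psiv]; split => // -[|l] /=.
    by rewrite addn0.
  by rewrite ltnS addnS -addSn => /vl.
move=> [vl psiv] /=; rewrite eqE; apply/andP; split.
  by have := vl 0%N isT; rewrite addn0 => ->.
by apply/IH; split => // l ll; have := vl l.+1 ll; rewrite addnS.
Qed.

Lemma oracle_grid_query (phi : lra) B w : lra_wf phi ->
  (lra_arity phi * B <= size w)%N ->
  O (enc_mixed (grid_query B (lra_dom phi) (lra_arity phi + lra_nex phi)
       (lra_matrix phi) w)) <->
  is_model phi (grid_tuple B (real_dom R phi) w).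
Proof.
move=> wf sw; have dom12 := real_dom_le R wf; case/andP: (wf) => _ wfm.
have sg : size (grid_tuple B (real_dom R phi) w) = lra_arity phi.
  by rewrite size_grid_tuple size_real_dom.
rewrite satO; last first.
  rewrite /mixed_wf /= size_nseq form_vars_lt_grid_form //.
  by rewrite add0n leq_addr.
rewrite mixed_sat_real; split=> [[x sx /feval_grid_form [//|xE fx]]|[_ [y sy fy]]].
  (* The query does not mention the domains: grid points lie in the box by construction. *)
  split; first by rewrite grid_tuple_in_box ?size_real_dom.
  exists (drop (lra_arity phi) x); first by rewrite size_drop sx addKn.
  rewrite (_ : grid_tuple _ _ _ = take (lra_arity phi) x) ?cat_take_drop //.
  have st : size (take (lra_arity phi) x) = lra_arity phi.
    by rewrite size_takel // sx leq_addr.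
  apply: (@eq_from_nth _ 0); rewrite sg ?st // => l lk.
  by rewrite nth_take // -xE.
exists (grid_tuple B (real_dom R phi) w ++ y); first by rewrite size_cat sg sy.
apply/feval_grid_form => //; split => // l lk.
by rewrite nth_cat sg lk.
Qed.

End Queries.

Section Semantics.
Variables (R : realType) (O : tree -> bool).
Hypothesis satO : is_sat_oracle R O.

Lemma grid_tuple_take B (dom : seq (R * R)) w :
  grid_tuple B dom (take (size dom * B) w) = grid_tuple B dom w.
Proof.
elim: dom w => //= d dom IH w; rewrite mulSn take_takel ?leq_addr //.
by rewrite [(B + _)%N]addnC -take_drop IH.
Qed.

Definition grid_indicator (phi : lra) (B : nat) (w : seq bool) : R :=
  (`[< is_model phi (grid_tuple B (real_dom R phi) w) >])%:R.

Lemma teval_sample_term (v : nat -> R) (phi : lra) B j w : lra_wf phi ->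
  (2 ^ j * (lra_arity phi * B) <= size w)%N ->
  teval v (sample_term O B (lra_dom phi) (lra_arity phi + lra_nex phi)
             (lra_matrix phi) j w) =
  sample_mean (lra_arity phi * B) (grid_indicator phi B) j w.
Proof.
move=> wf; elim: j w => [|j IHj] w sw /=.
  (* The query is built from the full list of coins, [sample_mean] from its first block; the grid
     point reads no further than that block. *)
  rewrite mul1n in sw; rewrite /grid_indicator -{2}(size_real_dom R phi) grid_tuple_take.
  have /= oE := oracle_grid_query satO wf sw.
  by case: asboolP => H; case: ifP => H'; rewrite ?Qval_Qone ?Qval_Qzero //;
    [move: (oE.2 H); rewrite H'|case: H; apply/oE].
move: sw; rewrite expnS -mulnA mul2n -addnn => sw.
have sw1 : (2 ^ j * (lra_arity phi * B) <= size w)%N by lia.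
have sw2 : (2 ^ j * (lra_arity phi * B) <=
    size (drop (2 ^ j * (lra_arity phi * B)) w))%N by rewrite size_drop; lia.
by rewrite Qval_Qhalf (IHj _ sw1) (IHj _ sw2) div1r mulrC.
Qed.

Lemma term_vars_lt_sample_term n B dom nv psi j w :
  term_vars_lt n (sample_term O B dom nv psi j w).
Proof. by elim: j w => //= j IHj w; rewrite !IHj. Qed.

Local Notation rdom dom := [seq (Qval R d.1, Qval R d.2) | d <- dom].

Lemma feval_volume_form (v : nat -> R) c i dom :
  feval v (volume_form c i dom) <->
  (forall l, (l < size dom)%N -> v (i + l).+1 =
     v (i + l)%N * ((nth (0, 0) (rdom dom) l).2 - (nth (0, 0) (rdom dom) l).1)) /\
  teval v c <= v (i + size dom)%N.
Proof.
elim: dom i => [|[a b] dom IHd] i /=; first by rewrite addn0; split=> // -[].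
have eqE : (v i.+1 + Qval R a * v i == Qval R b * v i) =
    (v i.+1 == v i * (Qval R b - Qval R a)).
  by apply/eqP/eqP => H; [lra|rewrite H; ring].
rewrite eqE addnS -addSn; split.
  move=> /andP[/eqP vi /IHd [vl cv]]; split=> // -[|l] /=; first by rewrite addn0.
  by rewrite ltnS addnS -addSn => /vl.
move=> [vl cv]; apply/andP; split.
  by have := vl 0%N isT; rewrite addn0 => ->.
by apply/IHd; split=> // l ll; have := vl l.+1 ll; rewrite addnS.
Qed.

Lemma chain_box_volume (v : nat -> R) (dom : seq (R * R)) :
  (forall l, (l < size dom)%N ->
     v l.+1 = v l * ((nth (0, 0) dom l).2 - (nth (0, 0) dom l).1)) ->
  v (size dom) = v 0 * box_volume dom.
Proof.
elim: dom v => [|d dom IHd] v vl; first by rewrite /box_volume big_nil mulr1.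
have /= -> := IHd (v \o S) (fun l ll => vl l.+1 ll).
by rewrite (vl 0%N) // /box_volume big_cons mulrA.
Qed.

(** The equations determine all variables, as partial products starting from [X], so satisfiability
    reduces to the final comparison. *)
Lemma oracle_bisect_query (U : term) (X : R) dom z t :
    (forall n, term_vars_lt n U) -> (forall v, teval v U = X) ->
  O (enc_mixed (bisect_query (FEq (TVar 0) U) dom z t)) <->
  (int_of_Z z)%:~R / 2 ^+ t <= X * box_volume (rdom dom).
Proof.
move=> Ucl UX; rewrite satO; last first.
  rewrite /mixed_wf /= size_nseq Ucl form_vars_lt_volume_form //.
rewrite mixed_sat_real -Qval_pow2; split.
  move=> [x sx] /= /andP[/eqP x0 /feval_volume_form]; rewrite !add0n => -[xl].
  have := @chain_box_volume (nth 0 x) (rdom dom); rewrite size_map => -> //.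
  by rewrite x0 UX.
move=> le; pose f l := X * box_volume (take l (rdom dom)).
have fE l : (l <= size dom)%N -> nth 0 (mkseq f (size dom).+1) l = f l.
  by move=> ll; rewrite nth_mkseq.
exists (mkseq f (size dom).+1); first by rewrite size_mkseq.
rewrite /= UX; apply/andP; split.
  by rewrite /f take0 /box_volume big_nil mulr1.
apply/feval_volume_form; split=> [l ll|].
  rewrite add0n !fE // 1?ltnW // /f (take_nth (0, 0)) ?size_map //.
  by rewrite /box_volume -cats1 big_cat big_seq1 /= mulrA.
by rewrite add0n fE //= /f take_oversize ?size_map.
Qed.

(** The invariant says that [a] is the integer part of 2^t Y; each query decides the next binary
    digit of Y. *)
Lemma bisect_spec (U : term) (X : R) dom n z t a (Y := X * box_volume (rdom dom)) :
    (forall n, term_vars_lt n U) -> (forall v, teval v U = X) ->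
    int_of_Z z = Posz a -> a%:R / 2 ^+ t <= Y < a.+1%:R / 2 ^+ t ->
  exists2 a', int_of_Z (bisect O (FEq (TVar 0) U) dom n z t) = Posz a' &
    a'%:R / 2 ^+ (t + n) <= Y < a'.+1%:R / 2 ^+ (t + n).
Proof.
move=> Ucl UX; elim: n z t a => [|n IHn] z t a zE /andP[aY Ya] /=.
  by exists a; rewrite ?addn0 ?aY.
have p0 : 2 ^+ t != 0 :> R by rewrite expf_neq0.
have Q1 := oracle_bisect_query dom (Zshift true z) t.+1 Ucl UX.
rewrite (int_of_Z_Zshift true zE) in Q1.
rewrite -addSnnS; case: ifP => Oq.
  apply: (IHn _ _ _ (int_of_Z_Zshift true zE)).
  rewrite (Q1.1 Oq) /=; apply: (lt_le_trans Ya).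
  rewrite le_eqVlt; apply/orP; left; apply/eqP.
  rewrite (_ : (1 + a.*2).+1 = 2 * a.+1)%N; last by lia.
  by rewrite natrM exprS; field.
apply: (IHn _ _ _ (int_of_Z_Zshift false zE)).
apply/andP; split.
  rewrite add0n -mul2n natrM exprS (_ : _ / _ = a%:R / 2 ^+ t) //.
  by field.
rewrite add0n ltNge; apply/negP => le.
by rewrite (Q1.2 le) in Oq.
Qed.

End Semantics.

(** * Magnitudes of numerals and volumes in terms of code sizes *)

Section Sizes.
Variable R : realType.

Lemma to_nat_lt_tsize p : (PosDef.Pos.to_nat p < 2 ^ Defs.tsize (enc_pos p))%N.
Proof.
elim: p => [p|p|] //=; rewrite ?to_nat_xI ?to_nat_xO; move: (Defs.tsize _) => n;
  rewrite ?add1n ?addSn ?add0n !expnS => IH; lia.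
Qed.

Lemma normr_int_of_Z z : `|(int_of_Z z)%:~R : R| <= 2 ^+ Defs.tsize (enc_Z z).
Proof.
have le p b : (PosDef.Pos.to_nat p)%:R <= 2 ^+ Defs.tsize (Node (tree_of_bool b) (enc_pos p)) :> R.
  rewrite -natrX ler_nat; apply: ltnW; apply: (leq_trans (to_nat_lt_tsize p)).
  by rewrite leq_exp2l //=; lia.
case: z => [|p|p].
- by rewrite /= normr0 exprn_ge0.
- by rewrite /= -pmulrn normr_nat; exact: (le p false).
- rewrite /= NegzE prednK; last by lia.
  by rewrite mulrNz normrN -pmulrn normr_nat; exact: (le p true).
Qed.

Lemma den_bounds q : 1 <= (int_of_Z (Zpos (QArith_base.Qden q)))%:~R :> R /\
  (int_of_Z (Zpos (QArith_base.Qden q)))%:~R <=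
    2 ^+ Defs.tsize (enc_pos (QArith_base.Qden q)) :> R.
Proof.
rewrite /= -!pmulrn; split; first by rewrite ler1n; lia.
by rewrite -natrX ler_nat ltnW // to_nat_lt_tsize.
Qed.

Lemma normr_Qval q : `|Qval R q| <= 2 ^+ Defs.tsize (enc_Q q).
Proof.
have [d1 _] := den_bounds q; rewrite /Qval normrM normfV.
rewrite (ger0_norm (le_trans ler01 d1)) ler_pdivrMr ?(lt_le_trans ltr01) //.
apply: (le_trans (normr_int_of_Z _)); apply: (@le_trans _ _ (2 ^+ Defs.tsize (enc_Q q))).
  by rewrite ler_eXn2l ?ltr1n //=; lia.
by rewrite ler_peMr ?exprn_ge0.
Qed.

(** Over the common denominator the numerator is a positive integer, hence at least 1. *)
Lemma Qval_diff_lower (a b : Q) : Qval R a < Qval R b ->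
  (2 ^+ (Defs.tsize (enc_Q a) + Defs.tsize (enc_Q b)))^-1 <= Qval R b - Qval R a.
Proof.
have [da1 da2] := den_bounds a; have [db1 db2] := den_bounds b.
rewrite /Qval; set na := int_of_Z (QArith_base.Qnum a); set nb := int_of_Z (QArith_base.Qnum b).
set da := int_of_Z (Zpos (QArith_base.Qden a)) in da1 da2 *.
set db := int_of_Z (Zpos (QArith_base.Qden b)) in db1 db2 *.
have da0 : 0 < da%:~R :> R by exact: lt_le_trans da1.
have db0 : 0 < db%:~R :> R by exact: lt_le_trans db1.
rewrite ltr_pdivrMr // mulrAC ltr_pdivlMr // -!intrM ltr_int => lt.
have -> : nb%:~R / db%:~R - na%:~R / da%:~R =
    (nb * da - na * db)%:~R / (da%:~R * db%:~R) :> R.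
  by rewrite intrB !intrM; field; rewrite !gt_eqF.
apply: (@le_trans _ _ (1 / (da%:~R * db%:~R))).
  rewrite div1r lef_pV2 ?posrE ?exprn_gt0 ?mulr_gt0 // exprD.
  apply: ler_pM; [exact: ltW|exact: ltW| |].
    by apply: (le_trans da2); rewrite ler_eXn2l ?ltr1n //=; lia.
  by apply: (le_trans db2); rewrite ler_eXn2l ?ltr1n //=; lia.
by rewrite ler_wpM2r ?invr_ge0 ?mulr_ge0 ?(ltW da0) ?(ltW db0) // ler1z -gtz0_ge1 subr_gt0.
Qed.

(** A side length is at most 2^(ta+tb+1) and, unless it vanishes, at least 2^-(ta+tb), for endpoints
    of sizes ta and tb; the bounds multiply along the list while sizes add. *)
Lemma box_volume_bounds (dom : seq (Q * Q)) :
    all (fun d => Qval R d.1 <= Qval R d.2) dom ->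
    let V := box_volume [seq (Qval R d.1, Qval R d.2) | d <- dom] in
  0 <= V <= 2 ^+ Defs.tsize (enc_dom dom) /\
  (V = 0 \/ (2 ^+ Defs.tsize (enc_dom dom))^-1 <= V).
Proof.
elim: dom => [|[a b] dom IH].
  rewrite /= => _; rewrite /box_volume big_nil; split; last right.
    by rewrite ler01 ler1n.
  by rewrite invf_le1 ?ler1n ?ltr0n.
rewrite [all _ _]/= => /andP[ab /IH [/andP[V0 V1] Vz]].
rewrite [map _ _]/= /box_volume big_cons [(_, _).1]/= [(_, _).2]/= -/(box_volume _).
have -> : Defs.tsize (enc_dom ((a, b) :: dom)) =
    ((Defs.tsize (enc_Q a) + Defs.tsize (enc_Q b)).+1 +
     (Defs.tsize (enc_dom dom)).+1)%N by rewrite addnS.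
move: V0 V1 Vz; move: (box_volume _) (Defs.tsize (enc_dom dom)) => V u V0 V1 Vz.
have := normr_Qval a; have := normr_Qval b; have := @Qval_diff_lower a b.
move: (Defs.tsize (enc_Q a)) (Defs.tsize (enc_Q b)) ab => ta tb ab low.
rewrite !ler_norml => /andP[_ leb] /andP[lea _].
set c := Qval R b - Qval R a in low *.
have c0 : 0 <= c by rewrite subr_ge0.
have leD m n : 2 ^+ m <= 2 ^+ (m + n) :> R by rewrite ler_eXn2l ?ltr1n // leq_addr.
have c1 : c <= 2 ^+ (ta + tb).+1.
  have := leD ta tb; have := leD tb ta; rewrite [(tb + ta)%N]addnC exprS /c.
  by move=> ? ?; lra.
have u0 : 0 < 2 ^+ u :> R by rewrite exprn_gt0.
have t0 : 0 < 2 ^+ (ta + tb) :> R by rewrite exprn_gt0.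
split.
  rewrite mulr_ge0 //= exprD ler_pM // (le_trans V1) // -[u.+1]addn1; exact: leD.
have [cz|cn] := eqVneq c 0; first by left; rewrite cz mul0r.
case: Vz => [->|Vl]; [by left; rewrite mulr0|right].
have cl : (2 ^+ (ta + tb))^-1 <= c.
  by apply: low; rewrite -subr_gt0 -/c lt_def cn.
apply: (@le_trans _ _ ((2 ^+ (ta + tb))^-1 * (2 ^+ u)^-1)).
  rewrite -invfM lef_pV2 ?posrE ?mulr_gt0 ?exprn_gt0 // -exprD.
  by rewrite ler_eXn2l ?ltr1n // leq_add.
by apply: ler_pM; rewrite // invr_ge0 ltW.
Qed.
End Sizes.

(** * Accuracy of the estimate *)

Section Tolerance.
Local Open Scope nat_scope.

Lemma pos_bits_bounds p : exists2 s, pos_bits p = true :: s &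
  2 ^ size s <= PosDef.Pos.to_nat p < 2 ^ (size s).+1.
Proof.
elim: p => [p [s ps le]|p [s ps le]|]; last by exists [::].
  exists (rcons s true); first by rewrite /= ps.
  by move: le; rewrite to_nat_xI size_rcons !expnS; lia.
exists (rcons s false); first by rewrite /= ps.
by move: le; rewrite to_nat_xO size_rcons !expnS; lia.
Qed.

Lemma find_fst_zip (s t : seq bool) : size s <= size t ->
  find fst (zip s t) = find id s.
Proof. by elim: s t => [|x s IHs] [|y t] //= st; rewrite IHs. Qed.

(** The number of zeros with which the numerator is padded; truncation makes it 0 when the numerator
    is the longer one. *)
Definition tolerance_exponent (n d : positive) : nat :=
  size (pos_bits d) - size (pos_bits n).

Lemma enc_tolerance_exponent n d : exists2 s : seq (bool * bool),
  enc_tolerance (QArith_base.Qmake (Zpos n) d) =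
    enc_seq (fun b => Node (tree_of_bool b.1) (tree_of_bool b.2)) s &
  find fst s = tolerance_exponent n d.
Proof.
eexists; first by reflexivity.
rewrite find_fst_zip; last first.
  by rewrite !size_cat !size_nseq !subnK ?leq_maxl ?leq_maxr.
have [s sE _] := pos_bits_bounds n; rewrite /tolerance_exponent sE.
rewrite find_cat has_nseq andbF /= addn0 size_nseq /=.
by lia.
Qed.

(** With gamma = n/d this reads 1/gamma <= 2^(e+1), used for accuracy, and 2^e <= 1 + 2/gamma, used
    for the running time. The summand 1 covers large gamma, where e = 0. *)
Lemma tolerance_exponent_bounds n d (e := tolerance_exponent n d) :
  PosDef.Pos.to_nat d <= 2 ^ e.+1 * PosDef.Pos.to_nat n /\
  2 ^ e * PosDef.Pos.to_nat n <= PosDef.Pos.to_nat n + 2 * PosDef.Pos.to_nat d.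
Proof.
rewrite /e /tolerance_exponent.
have [sn -> /= /andP[n1 n2]] := pos_bits_bounds n.
have [sd -> /= /andP[d1 d2]] := pos_bits_bounds d.
rewrite subSS; set x := size sd - size sn; split.
  apply: (leq_trans (ltnW d2)); apply: (@leq_trans (2 ^ x.+1 * 2 ^ size sn)).
    by rewrite -expnD leq_exp2l // /x; lia.
  by rewrite leq_mul2l n1 orbT.
have [le|lt] := leqP (size sd) (size sn).
  by rewrite (_ : x = 0) ?mul1n ?leq_addr // /x; lia.
apply: (@leq_trans (2 ^ x * 2 ^ (size sn).+1)); first by rewrite leq_mul2l (ltnW n2) orbT.
rewrite -expnD addnS (subnK (ltnW lt)) expnS.
by apply: (leq_trans _ (leq_addl _ _)); rewrite leq_mul2l d1 orbT.
Qed.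

End Tolerance.

Section Estimate.
Variables (R : realType) (O : tree -> bool).
Hypothesis satO : is_sat_oracle R O.
Variables (phi : lra) (e : nat).
Hypothesis wf : lra_wf phi.
Let M := precision phi e.
Let V := lra_bound R phi.
Let avg w := sample_mean (lra_arity phi * M) (grid_indicator R phi M) (8 + 2 * e) w.

Lemma grid_indicator01 B w : 0 <= grid_indicator R phi B w <= 1.
Proof. by rewrite /grid_indicator; case: (`[< _ >]); rewrite ?lexx ?ler01. Qed.

Lemma sample_mean01 b (g : seq bool -> R) j w : (forall w, 0 <= g w <= 1) ->
  0 <= sample_mean b g j w <= 1.
Proof.
move=> g01; elim: j w => [|j IHj] w //=.
have /andP[? ?] := IHj w; have /andP[? ?] := IHj (drop (2 ^ j * b) w).
by apply/andP; split; lra.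
Qed.

Lemma lra_boundE : V = box_volume (real_dom R phi).
Proof. by rewrite /V /lra_bound /box_volume big_map. Qed.

Lemma lra_bound_bounds : 0 <= V <= 2 ^+ lra_size phi /\
  (V = 0 \/ (2 ^+ lra_size phi)^-1 <= V).
Proof.
have dom12 : all (fun d => Qval R d.1 <= Qval R d.2) (lra_dom phi).
  by have := real_dom_le R wf; rewrite all_map.
have [/andP[V0 V1] Vz] := box_volume_bounds dom12.
have le : (Defs.tsize (enc_dom (lra_dom phi)) <= lra_size phi)%N.
  by have := lra_size_ge phi; lia.
have le' : 2 ^+ Defs.tsize (enc_dom (lra_dom phi)) <= 2 ^+ lra_size phi :> R.
  by rewrite ler_eXn2l ?ltr1n.
rewrite lra_boundE; split; first by rewrite V0 (le_trans V1).
case: Vz => [->|Vl]; [by left|right]; apply: le_trans Vl.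
by rewrite lef_pV2 ?posrE ?exprn_gt0.
Qed.

(** The second part is what a flat box needs: the estimate is rounded down from a nonnegative
    number, so it is exactly 0 there. *)
Lemma estimate_error w : (coins phi e <= size w)%N ->
  `|Qval R (estimate O phi e w) - V * avg w| <= (2 ^+ M)^-1 /\
  (V = 0 -> Qval R (estimate O phi e w) = 0).
Proof.
move=> sw.
pose S := sample_term O M (lra_dom phi) (lra_arity phi + lra_nex phi)
  (lra_matrix phi) (8 + 2 * e) w.
have Scl n : term_vars_lt n S.
  exact: (term_vars_lt_sample_term O n M (lra_dom phi) (lra_arity phi + lra_nex phi)).
have SX v : teval v S = avg w by exact: teval_sample_term.
pose U := TScale (QArith_base.Qmake (Zpos xH) (pow2_pos M)) S.
have UE : volume_eq O phi e w = FEq (TVar 0) U by [].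
clearbody S.
have Ucl n : term_vars_lt n U by exact: Scl.
have UX v : teval v U = (2 ^+ M)^-1 * avg w.
  by rewrite -(SX v) -[(2 ^+ M)^-1]mul1r -(Qval_pow2 R (Zpos xH)).
have [/andP[V0 V1] _] := lra_bound_bounds.
have /andP[avg0 avg1] : 0 <= avg w <= 1.
  by apply: sample_mean01 => ?; exact: grid_indicator01.
have M0 : 0 < 2 ^+ M :> R by rewrite exprn_gt0.
have VM : V < 2 ^+ M.
  by apply: (le_lt_trans V1); rewrite ltr_eXn2l ?ltr1n // /M /precision; lia.
have YE : (2 ^+ M)^-1 * avg w * V = V * avg w / 2 ^+ M by rewrite mulrC mulrCA mulrC.
have Y0 : 0%:R / 2 ^+ 0 <= (2 ^+ M)^-1 * avg w * V < 1%:R / 2 ^+ 0.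
  rewrite YE expr0 !divr1; apply/andP; split.
    by apply: divr_ge0; [exact: mulr_ge0|exact: ltW].
  by rewrite ltr_pdivrMr // mul1r (le_lt_trans _ VM) // ler_piMr.
rewrite lra_boundE in Y0.
have [a aE] := bisect_spec satO (M + M) Ucl UX (erefl : int_of_Z Z0 = Posz 0) Y0.
rewrite -/(real_dom R phi) -lra_boundE YE add0n => /andP[aY Ya].
have estE : Qval R (estimate O phi e w) = a%:R / 2 ^+ M.
  by rewrite /estimate Qval_pow2 -/M UE aE -pmulrn.
rewrite estE.
have powE (x : R) : x / 2 ^+ (M + M) * 2 ^+ M = x / 2 ^+ M.
  by rewrite exprD; field; rewrite gt_eqF.
have aY' : a%:R / 2 ^+ M <= V * avg w.
  by rewrite -powE -ler_pdivlMr.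
have Ya' : V * avg w < a.+1%:R / 2 ^+ M.
  by rewrite -powE -ltr_pdivrMr.
split.
  move: Ya'; rewrite -natr1 mulrDl mul1r => Ya'.
  have : 0 <= (2 ^+ M)^-1 :> R by rewrite invr_ge0 ltW.
  by move=> ?; rewrite ler_norml; apply/andP; split; lra.
move=> Vz; apply/eqP; rewrite eq_le; apply/andP; split.
  by move: aY'; rewrite Vz mul0r.
by rewrite divr_ge0 // ltW.
Qed.

Variable g : R.
Hypotheses (g0 : 0 < g) (ge : g^-1 <= 2 ^+ e.+1).

Let e_lower : (2 ^+ e.+1)^-1 <= g.
Proof. by rewrite -[leRHS]invrK lef_pV2 ?posrE ?invr_gt0 ?exprn_gt0. Qed.

Lemma size_atoms (f : Defs.form) : (size (atoms f) <= Defs.tsize (enc_form f))%N.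
Proof. by elim: f => //= *; rewrite ?size_cat; lia. Qed.

Lemma discretization_error :
  `|model_count R phi - V * coin_mean (lra_arity phi * M) (grid_indicator R phi M)|
    <= V * (g / 4).
Proof.
apply: (le_trans (model_count_grid R M wf)).
have [/andP[V0 _] _] := lra_bound_bounds.
rewrite -mulrA ler_wpM2l //.
have M0 : 0 < 2 ^+ M :> R by rewrite exprn_gt0.
rewrite ler_pdivrMr //.
apply: (@le_trans _ _ ((2 ^+ e.+1)^-1 / 4 * 2 ^+ M)); last first.
  by rewrite ler_pM2r // ler_pM2r ?invr_gt0.
(* In exponents of 2: |phi| for the arity, 1 + 2|phi| for twice the number of sign vectors, and e +
   3 for gamma/4, in total 3|phi| + e + 4. *)
have kM : (lra_arity phi * (2 * 3 ^ size (atoms (lra_matrix phi))) * 2 ^ (e.+1 + 2) <= 2 ^ M)%N.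
  have kl : (lra_arity phi <= 2 ^ lra_size phi)%N.
    apply: leq_trans (ltnW (ltn_expl _ (isT : 1 < 2)%N)).
    by have := arity_le_size phi; lia.
  have l3 : (3 ^ size (atoms (lra_matrix phi)) <= 2 ^ (2 * lra_size phi))%N.
    rewrite expnM; apply: (@leq_trans (3 ^ lra_size phi)); last first.
      by rewrite leq_exp2r //; have := arity_le_size phi; lia.
    rewrite leq_exp2l //; apply: leq_trans (size_atoms _) _.
    by have := lra_size_ge phi; lia.
  apply: (@leq_trans (2 ^ lra_size phi * (2 * 2 ^ (2 * lra_size phi)) * 2 ^ (e.+1 + 2))).
    by rewrite leq_mul2r leq_mul ?orbT // leq_mul2l l3.
  by rewrite -expnS -!expnD leq_exp2l // /M /precision; lia.
have : (lra_arity phi * (2 * 3 ^ size (atoms (lra_matrix phi))))%:R *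
    2 ^+ (e.+1 + 2) <= 2 ^+ M :> R.
  by rewrite -!natrX -natrM ler_nat.
rewrite -ler_pdivlMr ?exprn_gt0 // => /le_trans; apply.
by rewrite [leRHS]mulrC exprD invfM (_ : 2 ^+ 2 = 4) // expr2 -natrM.
Qed.

Lemma rounding_error : V = 0 \/ (2 ^+ M)^-1 <= V * (g / 4).
Proof.
have [_ [->|Vl]] := lra_bound_bounds; [by left|right].
apply: (@le_trans _ _ ((2 ^+ lra_size phi)^-1 * ((2 ^+ e.+1)^-1 / 4))).
  rewrite (_ : 4 = 2 ^+ 2); last by rewrite expr2 -natrM.
  rewrite -!invfM -!exprD lef_pV2 ?posrE ?exprn_gt0 //.
  by rewrite ler_eXn2l ?ltr1n // /M /precision; lia.
apply: ler_pM => //; rewrite ?invr_ge0 ?divr_ge0 ?invr_ge0 ?exprn_ge0 //.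
by rewrite ler_pM2r ?invr_gt0.
Qed.

Lemma estimate_accurate w : (coins phi e <= size w)%N ->
  `|avg w - coin_mean (lra_arity phi * M) (grid_indicator R phi M)| <= g / 4 ->
  `|Qval R (estimate O phi e w) - model_count R phi| <= g * V.
Proof.
move=> sw; set mu := coin_mean _ _ => good.
have [/andP[V0 _] _] := lra_bound_bounds.
have disc := discretization_error; rewrite -/mu in disc.
have [err errz] := estimate_error sw.
have [Vz|round] := rounding_error.
  rewrite (errz Vz) sub0r normrN Vz mulr0.
  by move: disc; rewrite Vz !mul0r subr0.
have samp : `|V * avg w - V * mu| <= V * (g / 4).
  by rewrite -mulrBr normrM (ger0_norm V0) ler_wpM2l.
have gV : 0 <= V * (g / 4) by rewrite mulr_ge0 ?divr_ge0 // ltW.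
move: disc err samp; rewrite !ler_norml => /andP[? ?] /andP[? ?] /andP[? ?].
by rewrite [g * V]mulrC; apply/andP; split; lra.
Qed.

Lemma coin_probE n (E : pred (seq bool)) :
  coin_prob R (fun w : n.-tuple bool => E w) = coin_mean n (fun w => (E w)%:R).
Proof.
rewrite coin_mean_sum /coin_prob -sum1_card natr_sum big_mkcond /=; congr (_ / _).
by apply: eq_bigr => w _; rewrite unfold_in; case: (E w).
Qed.

Lemma estimate_prob n : (coins phi e <= n)%N ->
  3 / 4 <= coin_prob R (fun w : n.-tuple bool =>
    `|Qval R (estimate O phi e w) - model_count R phi| <= g * V).
Proof.
move=> cn; rewrite (coin_probE n (fun w =>
  `|Qval R (estimate O phi e w) - model_count R phi| <= g * V)).
pose mu := coin_mean (lra_arity phi * M) (grid_indicator R phi M).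
apply: (@le_trans _ _ (coin_mean n (fun w => (`|avg w - mu| <= g / 4)%R%:R))); last first.
  apply: le_coin_mean => w sw; rewrite ler_nat.
  by case: (lerP `|avg w - mu|) => // good; rewrite estimate_accurate // sw.
(* Coins beyond the first [coins phi e] do not affect the mean and average out. *)
rewrite -(subnKC cn) coin_mean_cat.
rewrite (eq_coin_mean (g := fun u => (`|avg u - mu| <= g / 4)%R%:R)); last first.
  move=> u su; rewrite -[RHS](coin_mean_cst (n - coins phi e)).
  by apply: eq_coin_mean => v _; rewrite /avg sample_mean_cat.
have t0 : 0 < g / 4 by rewrite divr_gt0.
apply: le_trans (sample_mean_chebyshev (lra_arity phi * M) (8 + 2 * e)
  (grid_indicator01 M) t0).
rewrite (_ : 3 / 4 = 1 - 1 / 4); last by field.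
have J0 : 0 < 2 ^+ (8 + 2 * e) :> R by rewrite exprn_gt0.
have J1 : 0 < 2 ^+ (8 + 2 * e) * (g / 4) ^+ 2 by rewrite (mulr_gt0 J0) ?exprn_gt0.
rewrite lerD2l lerN2 !div1r lef_pV2 ?posrE ?J1 ?ltr0n //.
have g2 : (2 ^+ e.+1)^-1 * (2 ^+ e.+1)^-1 <= g * g.
  by apply: ler_pM; rewrite ?invr_ge0 ?exprn_ge0.
rewrite expr_div_n (_ : 4 ^+ 2 = 16); last by rewrite expr2 -natrM.
(* Replacing gamma by its lower bound 2^-(e+1) gives 2^(8+2e) 2^-(2e+2) / 16 = 4, so the failure
   probability is at most 1/4. *)
apply: (@le_trans _ _ (2 ^+ (8 + 2 * e) * ((2 ^+ e.+1)^-1 * (2 ^+ e.+1)^-1 / 16))).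
  have p0 : 2 ^+ e != 0 :> R by rewrite expf_neq0.
  have p8 : 2 ^+ 8 = 256 :> R by rewrite -natrX.
  rewrite exprD p8 mulnC exprM expr2 [2 ^+ e.+1]exprS.
  set x := 2 ^+ e in p0 *.
  by rewrite (_ : _ * _ = 4); [|field].
by rewrite (ler_pM2l J0) ler_pM2r ?invr_gt0 // expr2.
Qed.

End Estimate.

(** Since 1 <= x and e <= 2^e <= 2x, the precision is at most 3x + 6x + 2x = 11x, and the number of
    samples at most 256 (2x)^2 = 1024 x^2. *)
Lemma run_time_bound (R : realType) (phi : lra) (e : nat) (x : R) :
  (lra_size phi)%:R <= x -> 2 ^+ e <= 2 * x ->
  (run_time phi e)%:R <= ((2000 * 1024 * 11 ^+ 3) *: 'X^5 : {poly R}).[x].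
Proof.
move=> sx ex; rewrite hornerZ hornerXn /run_time natrM [(expn _ _ * _)%:R]natrM !natrX.
have s1 : 1 <= (lra_size phi)%:R :> R by rewrite ler1n; have := arity_le_size phi; lia.
have x1 : 1 <= x by exact: le_trans sx.
have e1 : e%:R <= 2 ^+ e :> R by rewrite -natrX ler_nat ltnW // ltn_expl.
have Mx : (precision phi e)%:R <= 11 * x.
  by rewrite /precision !natrD natrM; lra.
have M3 : (precision phi e)%:R ^+ 3 <= (11 * x) ^+ 3.
  by rewrite ler_pXn2r ?nnegrE //; lra.
have e2 : 2 ^+ (8 + 2 * e) <= 1024 * x ^+ 2.
  have p8 : 2 ^+ 8 = 256 :> R by rewrite -natrX.
  rewrite exprD p8 mulnC exprM.
  have : (2 ^+ e) ^+ 2 <= (2 * x) ^+ 2 by rewrite ler_pXn2r ?nnegrE ?exprn_ge0 //; lra.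
  by rewrite exprMn; lra.
rewrite (_ : _ * x ^+ 5 = 2000 * (1024 * x ^+ 2 * (11 * x) ^+ 3)); last by ring.
apply: ler_wpM2l; first exact: ler0n.
apply: ler_pM; [by rewrite exprn_ge0|by rewrite exprn_ge0|exact: e2|exact: M3].
Qed.

Lemma runs_within_main (O : tree -> bool) (phi : lra) (n d : positive) w :
  let e := tolerance_exponent n d in
  (coins phi e <= size w)%N ->
  runs_within counting_program O (run_time phi e)
    (enc_input phi (QArith_base.Qmake (Zpos n) d)) w (enc_Q (estimate O phi e w)).
Proof.
move=> e sw; have [s sE se] := enc_tolerance_exponent n d.
rewrite /enc_input sE.
have := @calls_main O phi s w; rewrite se -/e => /(_ sw) call.
have [body _ [c0 ev0 le0]] := call.
(* Every evaluation has positive cost, so the truncated subtraction in the bound of [calls_main] is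
   genuine. *)
have c0_gt0 : (0 < c0)%N by case: ev0.
have inE : runs O [:: Node (enc_lra phi) (enc_seq (fun b =>
    Node (tree_of_bool b.1) (tree_of_bool b.2)) s)] w (EVar 0) _ w 1 :=
  runs_var O w (erefl _).
have [c ec le] := runs_call inE call.
exists (drop (coins phi e) w), c; split; first exact: ec.
by lia.
Qed.

Theorem theorem2 (R : realType) :
  exists (P : program) (p : {poly R}),
    forall O : tree -> bool, is_sat_oracle R O ->
    forall (phi : lra) (gamma : Q), lra_wf phi -> 0 < Qval R gamma ->
    exists (n : nat) (A : n.-tuple bool -> Q),
      [/\ n%:R <= p.[(lra_size phi)%:R + (Qval R gamma)^-1],
          forall w : n.-tuple bool,
            runs_within P O n (enc_input phi gamma) w (enc_Q (A w)) &
          3 / 4 <= coin_prob R (fun w : n.-tuple bool =>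
            `|Qval R (A w) - model_count R phi|
              <= Qval R gamma * lra_bound R phi)].
Proof.
exists counting_program, ((2000 * 1024 * 11 ^+ 3) *: 'X^5).
move=> O satO phi [[|n|n] d] wf g0.
- by rewrite /Qval /= mul0r ltxx in g0.
- pose e := tolerance_exponent n d.
  have [ge1 ge2] := tolerance_exponent_bounds n d; rewrite -/e in ge1 ge2.
  have [n0 d0] : (0 < PosDef.Pos.to_nat n)%N /\ (0 < PosDef.Pos.to_nat d)%N by lia.
  have nR : 0 < (PosDef.Pos.to_nat n)%:R :> R by rewrite ltr0n.
  set g := Qval R _ in g0 *.
  have gE : g^-1 = (PosDef.Pos.to_nat d)%:R / (PosDef.Pos.to_nat n)%:R.
    by rewrite /g /Qval /= -!pmulrn invf_div.
  have gle : g^-1 <= 2 ^+ e.+1.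
    by rewrite gE ler_pdivrMr // -natrX -natrM ler_nat.
  (* The time bound also serves as the number of coins supplied, which is enough by
     [coins_le_run_time]. *)
  exists (run_time phi e), (estimate O phi e); split.
  + apply: run_time_bound; first by rewrite lerDl invr_ge0 ltW.
    apply: (@le_trans _ _ (1 + 2 * g^-1)).
      rewrite gE mulrA -(ler_pM2r nR) mulrDl mul1r divfK ?gt_eqF //.
      by rewrite -natrX -!natrM -natrD ler_nat.
    have s1 : 1 <= (lra_size phi)%:R :> R.
      by rewrite ler1n; have := arity_le_size phi; lia.
    by lra.
  + move=> w; apply: runs_within_main.
    by rewrite size_tuple coins_le_run_time.
  + exact: (estimate_prob satO wf g0 gle (coins_le_run_time phi e)).
- suff : Qval R (QArith_base.Qmake (Zneg n) d) <= 0 by rewrite leNgt g0.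
  rewrite /Qval /= mulNr oppr_le0 divr_ge0 //.
Qed.
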